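(* Let $\mathcal{P}$ and $\mathcal{P}'$ be two pseudo order ideals in $P$ with $\#\mathcal{P}=\#\mathcal{P}'=\mu$, with pseudo borders $b\mathcal{P}$ and $b\mathcal{P}'$ of cardinalities $\alpha$ and $\alpha'$. Let $C=(c_{ij})$ and $D=(d_{ij})$ be matrices of indeterminates of sizes $\mu\times\alpha$ and $\mu\times\alpha'$, used as coordinates for $\mathbb{B}_{\mathcal{P}}$ and $\mathbb{B}_{\mathcal{P}'}$, respectively. Let $M_C,N_C$ be matrices over $K[c_{ij}]$ such that $\mathcal{P}'=\mathcal{P}\cdot M_C$ and $b\mathcal{P}'=\mathcal{P}\cdot N_C$ hold over $U_{\mathcal{P}}$, and let $M_D,N_D$ be matrices over $K[d_{ij}]$ such that $\mathcal{P}=\mathcal{P}'\cdot M_D$ and $b\mathcal{P}=\mathcal{P}'\cdot N_D$ hold over $U_{\mathcal{P}'}$. (a) The set $\mathbb{B}_{\mathcal{P},\mathcal{P}'}$ is the open subset of $\mathbb{B}_{\mathcal{P}}$ defined by $\det(M_C)\ne 0$, and the set $\mathbb{B}_{\mathcal{P}',\mathcal{P}}$ is the open subset of $\mathbb{B}_{\mathcal{P}'}$ defined by $\det(M_D)\ne 0$. (b) The natural maps defining the identity map between $\mathbb{B}_{\mathcal{P},\mathcal{P}'}$ and $\mathbb{B}_{\mathcal{P}',\mathcal{P}}$ (i.e. identifying the points that correspond to the same ideal) in terms of their respective systems of coordinates are given parametrically by $$D=M_C^{-1}\cdot N_C\quad\text{and}\quad C=M_D^{-1}\cdot N_D .$$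 That is, the $K$-algebra homomorphisms $(B_{\mathcal{P}'})_{\det(M_D)}\to(B_{\mathcal{P}})_{\det(M_C)}$, $d_{ij}\mapsto(M_C^{-1}N_C)_{ij}$, and $(B_{\mathcal{P}})_{\det(M_C)}\to(B_{\mathcal{P}'})_{\det(M_D)}$, $c_{ij}\mapsto(M_D^{-1}N_D)_{ij}$, are well-defined, mutually inverse, and induce this identification.
   Context: $K$ is a field, $P=K[x_1,\dots,x_n]$, and $\mathbb{T}^n$ is the monoid of terms (power products) $x_1^{a_1}\cdots x_n^{a_n}$. A linear change of coordinates is a $K$-algebra automorphism $\varphi:P\to P$ mapping each indeterminate to a (not necessarily homogeneous) linear polynomial. An order ideal is a finite nonempty set $\mathcal{O}\subset\mathbb{T}^n$ closed under forming divisors. Its border is $\partial\mathcal{O}=(x_1\mathcal{O}\cup\cdots\cup x_n\mathcal{O})\setminus\mathcal{O}$. Its corner set $c\mathcal{O}$ is the set of minimal monomial generators of the monomial ideal $\mathbb{T}^n\setminus\mathcal{O}$. For a term ordering $\sigma$, $\mathcal{O}$ is a $\sigma$-cornercut if $b>_\sigma t$ for all $b\in c\mathcal{O}$ and $t\in\mathcal{O}$. A set of polynomials $\mathcal{P}$ is a pseudo order ideal with pseudo border $b\mathcal{P}$ if one of the following holds for some linear change of coordinates $\varphi$: (i) $\mathcal{P}=\varphi(\mathcal{O})$ for an order ideal $\mathcal{O}$ and $b\mathcal{P}=\varphi(\partial\mathcal{O})$; or (ii) $\mathcal{P}=\varphi(\mathcal{O})$ for a $\sigma$-cornercut $\mathcal{O}$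 (for some term ordering $\sigma$) and $b\mathcal{P}=\varphi(c\mathcal{O})$. $\mathcal{P}$ is a basis modulo an ideal $I\subset P$ if the residue classes of its elements form a $K$-basis of $P/I$. Sets such as $\mathcal{P}=\{t_1,\dots,t_\mu\}$ and $b\mathcal{P}=\{b_1,\dots,b_\alpha\}$ are treated as row vectors in matrix equalities. For $\mathcal{P}$ with coordinates $c_{ij}$ put $g_j=b_j-\sum_{i=1}^\mu c_{ij}t_i$ ($j=1,\dots,\alpha$). The ideal $I(\mathbb{B}_{\mathcal{P}})\subset K[c_{ij}]$ is defined as follows. For an order ideal $\mathcal{O}=\{o_1,\dots,o_\mu\}$ with border $\partial\mathcal{O}=\{\beta_1,\dots,\beta_\nu\}$, the formal multiplication matrix $\mathcal{A}_k$ ($1\le k\le n$) is the $\mu\times\mu$ matrix whose $m$-th column is the $i$-th standard basis vector if $x_ko_m=o_i\in\mathcal{O}$, and $(c_{1j},\dots,c_{\mu j})^{\rm tr}$ if $x_ko_m=\beta_j\in\partial\mathcal{O}$; $I(\mathbb{B}_{\mathcal{O}})$ is generated by the entries of all commutators $\mathcal{A}_k\mathcal{A}_\ell-\mathcal{A}_\ell\mathcal{A}_k$. In case (i) with $t_i=\varphi(o_i)$, $b_j=\varphi(\beta_j)$, one sets $I(\mathbb{B}_{\mathcal{P}})=I(\mathbb{B}_{\mathcal{O}})$. In case (ii), where the $b_j$ are the images of the corners only, $I(\mathbb{B}_{\mathcal{P}})=I(\mathbb{B}_{\mathcal{O}})\cap K[c_{ij}\mid\beta_j\in c\mathcal{O}]$.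 Put $B_{\mathcal{P}}=K[c_{ij}]/I(\mathbb{B}_{\mathcal{P}})$, $\mathbb{B}_{\mathcal{P}}=\mathrm{Spec}(B_{\mathcal{P}})$, and $U_{\mathcal{P}}=K[x_1,\dots,x_n,c_{ij}]/\bigl(I(\mathbb{B}_{\mathcal{P}})+(g_1,\dots,g_\alpha)\bigr)$, which is a free $B_{\mathcal{P}}$-module with basis $\mathcal{P}$. The $K$-rational points of $\mathbb{B}_{\mathcal{P}}$ correspond to the ideals $I$ for which $\mathcal{P}$ is a basis modulo $I$. The same notation is used for $\mathcal{P}'$ with coordinates $d_{ij}$. $\mathbb{B}_{\mathcal{P},\mathcal{P}'}$ denotes the open subset of $\mathbb{B}_{\mathcal{P}}$ parametrizing the ideals for which $\mathcal{P}'$ is also a basis, i.e. the set of points $p\in\mathbb{B}_{\mathcal{P}}$ with residue field $\kappa(p)$ such that the classes of the elements of $\mathcal{P}'$ form a $\kappa(p)$-basis of $U_{\mathcal{P}}\otimes_{B_{\mathcal{P}}}\kappa(p)$; $\mathbb{B}_{\mathcal{P}',\mathcal{P}}\subseteq\mathbb{B}_{\mathcal{P}'}$ is defined analogously. Matrices $M_C,N_C,M_D,N_D$ as in the claim exist. *)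

(* Defs.v *)
From HB Require Import structures.
From mathcomp Require Import all_boot all_algebra generic_quotient fraction.
From mathcomp Require Import ring.
From mathcomp Require Import boolp.
From mathcomp Require Import freeg mpoly.

Set Implicit Arguments.
Unset Strict Implicit.
Unset Printing Implicit Defensive.

Import GRing.Theory.

Local Open Scope ring_scope.
Local Open Scope quotient_scope.

(* ring_quotient only offers quotients by decidable proper ideals, and
   MathComp has no localization of rings with zero divisors.  Quotients,
   localizations and residue fields are therefore built here, over arbitrary
   (possibly zero) commutative rings. *)

Record ideal (R : comPzRingType) := Ideal {
  ideal_mem :> R -> Prop;
  ideal0 : ideal_mem 0;
  idealD : forall x y, ideal_mem x -> ideal_mem y -> ideal_mem (x + y);
  idealM : forall a x, ideal_mem x -> ideal_mem (a * x)
}.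

Section IdealTheory.
Variable R : comPzRingType.

Lemma idealN (I : ideal R) x : I x -> I (- x).
Proof. by move=> Ix; rewrite -mulN1r; apply: idealM. Qed.

Lemma idealB (I : ideal R) x y : I x -> I y -> I (x - y).
Proof. by move=> Ix Iy; apply: idealD => //; apply: idealN. Qed.

Lemma ideal_sum (I : ideal R) (T : Type) (s : seq T) (P : pred T) (F : T -> R) :
  (forall i, P i -> I (F i)) -> I (\sum_(i <- s | P i) F i).
Proof. by move=> IF; apply: big_ind => //; [apply: ideal0 | apply: idealD]. Qed.

Definition gen_mem (S : R -> Prop) (x : R) : Prop :=
  exists (m : nat) (a s : 'I_m -> R),
    (forall i, S (s i)) /\ x = \sum_(i < m) a i * s i.

Lemma gen_mem0 S : gen_mem S 0.
Proof.
exists 0%N, (fun=> 0), (fun=> 0); split; first by case.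
by rewrite big_ord0.
Qed.

Lemma gen_memD S x y : gen_mem S x -> gen_mem S y -> gen_mem S (x + y).
Proof.
move=> [m [a [s [Ss ->]]]] [m' [a' [s' [Ss' ->]]]].
exists (m + m')%N,
  (fun i => match split i with inl j => a j | inr j => a' j end),
  (fun i => match split i with inl j => s j | inr j => s' j end).
split; first by move=> i; case: (split i).
rewrite big_split_ord /=; congr (_ + _); apply: eq_bigr => i _.
  by rewrite (unsplitK (inl i)).
by rewrite (unsplitK (inr i)).
Qed.

Lemma gen_memM S b x : gen_mem S x -> gen_mem S (b * x).
Proof.
move=> [m [a [s [Ss ->]]]]; exists m, (fun i => b * a i), s; split=> //.
by rewrite mulr_sumr; apply: eq_bigr => i _; rewrite mulrA.
Qed.

Definition ideal_gen (S : R -> Prop) : ideal R :=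
  Ideal (gen_mem0 S) (@gen_memD S) (@gen_memM S).

Lemma mem_ideal_gen (S : R -> Prop) x : S x -> ideal_gen S x.
Proof.
move=> Sx; exists 1%N, (fun=> 1), (fun=> x); split=> //.
by rewrite big_ord1 mul1r.
Qed.

Lemma ideal_gen_min (S : R -> Prop) (I : ideal R) :
  (forall x, S x -> I x) -> forall x, ideal_gen S x -> I x.
Proof.
move=> SI x [m [a [s [Ss ->]]]]; apply: ideal_sum => i _.
exact/idealM/SI.
Qed.

End IdealTheory.

Section Comap.
Variables (R S : comPzRingType) (f : {rmorphism R -> S}) (J : ideal S).

Lemma comap0 : J (f 0). Proof. by rewrite rmorph0; apply: ideal0. Qed.

Lemma comapD x y : J (f x) -> J (f y) -> J (f (x + y)).
Proof. by rewrite rmorphD; apply: idealD. Qed.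

Lemma comapM a x : J (f x) -> J (f (a * x)).
Proof. by rewrite rmorphM; apply: idealM. Qed.

Definition ideal_comap : ideal R := Ideal comap0 comapD comapM.

End Comap.

Section Quotient.
Variables (R : comPzRingType) (I : ideal R).

Definition requiv (x y : R) : bool := `[< I (x - y) >].

Lemma requiv_refl : reflexive requiv.
Proof. by move=> x; apply/asboolP; rewrite subrr; apply: ideal0. Qed.

Lemma requiv_sym : ssrbool.symmetric requiv.
Proof.
by move=> x y; apply/asboolP/asboolP => /idealN; rewrite opprB.
Qed.

Lemma requiv_trans : transitive requiv.
Proof.
move=> y x z /asboolP xy /asboolP yz; apply/asboolP.
by rewrite -[x](subrK y) -addrA; apply: idealD.
Qed.

Canonical requiv_equiv := EquivRel requiv requiv_refl requiv_sym requiv_trans.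

Definition rquot := {eq_quot requiv}.

HB.instance Definition _ : EqQuotient R requiv rquot := EqQuotient.on rquot.
HB.instance Definition _ := Choice.on rquot.

Lemma rquotP x y : reflect (I (x - y)) (\pi_rquot x == \pi_rquot y).
Proof. by rewrite eqmodE; apply: asboolP. Qed.

Lemma rquot_eq x y : I (x - y) -> \pi_rquot x = \pi_rquot y.
Proof. by move/rquotP/eqP. Qed.

Lemma rquot_repr x : I (x - repr (\pi_rquot x)).
Proof. by apply/rquotP; rewrite reprK. Qed.

Definition rquot_zero : rquot := lift_cst rquot 0.
Definition rquot_one : rquot := lift_cst rquot 1.
Definition rquot_opp := lift_op1 rquot -%R.
Definition rquot_add := lift_op2 rquot +%R.
Definition rquot_mul := lift_op2 rquot *%R.

Canonical rquot_zero_morph := PiConst rquot_zero.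
Canonical rquot_one_morph := PiConst rquot_one.

Lemma pi_rquot_opp : {morph \pi : x / - x >-> rquot_opp x}.
Proof.
move=> x; unlock rquot_opp; apply: rquot_eq.
by rewrite -opprD; apply/idealN/rquot_repr.
Qed.
Canonical rquot_opp_morph := PiMorph1 pi_rquot_opp.

Lemma pi_rquot_add : {morph \pi : x y / x + y >-> rquot_add x y}.
Proof.
move=> x y; unlock rquot_add; apply: rquot_eq.
by rewrite opprD addrACA; apply: idealD; apply: rquot_repr.
Qed.
Canonical rquot_add_morph := PiMorph2 pi_rquot_add.

Lemma pi_rquot_mul : {morph \pi : x y / x * y >-> rquot_mul x y}.
Proof.
move=> x y; unlock rquot_mul; apply: rquot_eq.
set x' := repr _; set y' := repr _.
have -> : x * y - x' * y' = y * (x - x') + x' * (y - y').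
  by rewrite !mulrBr addrA mulrC [y * x']mulrC subrK.
by apply: idealD; apply/idealM/rquot_repr.
Qed.
Canonical rquot_mul_morph := PiMorph2 pi_rquot_mul.

Lemma rquot_addA : associative rquot_add.
Proof. by move=> x y z; rewrite -[x]reprK -[y]reprK -[z]reprK !piE addrA. Qed.

Lemma rquot_addC : commutative rquot_add.
Proof. by move=> x y; rewrite -[x]reprK -[y]reprK !piE addrC. Qed.

Lemma rquot_add0 : left_id rquot_zero rquot_add.
Proof. by move=> x; rewrite -[x]reprK !piE add0r. Qed.

Lemma rquot_addN : left_inverse rquot_zero rquot_opp rquot_add.
Proof. by move=> x; rewrite -[x]reprK !piE addNr. Qed.

HB.instance Definition _ :=
  GRing.isZmodule.Build rquot rquot_addA rquot_addC rquot_add0 rquot_addN.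

Lemma rquot_mulA : associative rquot_mul.
Proof. by move=> x y z; rewrite -[x]reprK -[y]reprK -[z]reprK !piE mulrA. Qed.

Lemma rquot_mulC : commutative rquot_mul.
Proof. by move=> x y; rewrite -[x]reprK -[y]reprK !piE mulrC. Qed.

Lemma rquot_mul1 : left_id rquot_one rquot_mul.
Proof. by move=> x; rewrite -[x]reprK !piE mul1r. Qed.

Lemma rquot_mulDl : left_distributive rquot_mul rquot_add.
Proof.
move=> x y z; rewrite -[x]reprK -[y]reprK -[z]reprK.
by rewrite !piE mulrDl.
Qed.

HB.instance Definition _ := GRing.Zmodule_isComPzRing.Build rquot
  rquot_mulA rquot_mulC rquot_mul1 rquot_mulDl.

Definition rproj (x : R) : rquot := \pi_rquot x.

Lemma rproj_is_zmod_morphism : zmod_morphism rproj.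
Proof. by move=> x y; rewrite /rproj pi_rquot_add pi_rquot_opp. Qed.

Lemma rproj_is_monoid_morphism : monoid_morphism rproj.
Proof.
split=> [|x y]; rewrite /rproj ?pi_rquot_mul //.
have -> : (1 : rquot) = rquot_one by [].
by rewrite piE.
Qed.

HB.instance Definition _ :=
  GRing.isZmodMorphism.Build R rquot rproj rproj_is_zmod_morphism.
HB.instance Definition _ :=
  GRing.isMonoidMorphism.Build R rquot rproj rproj_is_monoid_morphism.

Lemma rproj_eq0 x : rproj x = 0 <-> I x.
Proof.
rewrite -[in X in _ = X](rmorph0 rproj) -[in X in _ <-> X](subr0 x).
by split=> [/eqP/rquotP | /rquotP/eqP].
Qed.

Lemma rproj_surj (y : rquot) : exists x, y = rproj x.
Proof. by exists (repr y); rewrite /rproj reprK. Qed.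

Section Lift.
Variables (S : pzRingType) (f : {rmorphism R -> S}).
Hypothesis fI : forall x, I x -> f x = 0.

Definition rquot_lift_fun (x : rquot) : S := f (repr x).

Lemma rquot_lift_rproj x : rquot_lift_fun (rproj x) = f x.
Proof.
apply/esym/eqP; rewrite /rquot_lift_fun -subr_eq0 -rmorphB.
exact/eqP/fI/rquot_repr.
Qed.

Lemma rquot_lift_is_zmod_morphism : zmod_morphism rquot_lift_fun.
Proof.
move=> x y; have [a ->] := rproj_surj x; have [b ->] := rproj_surj y.
by rewrite -rmorphB !rquot_lift_rproj rmorphB.
Qed.

Lemma rquot_lift_is_monoid_morphism : monoid_morphism rquot_lift_fun.
Proof.
split=> [|x y]; first by rewrite -(rmorph1 rproj) rquot_lift_rproj rmorph1.
have [a ->] := rproj_surj x; have [b ->] := rproj_surj y.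
by rewrite -rmorphM !rquot_lift_rproj rmorphM.
Qed.

HB.instance Definition _ := GRing.isZmodMorphism.Build rquot S
  rquot_lift_fun rquot_lift_is_zmod_morphism.
HB.instance Definition _ := GRing.isMonoidMorphism.Build rquot S
  rquot_lift_fun rquot_lift_is_monoid_morphism.

Definition rquot_lift : {rmorphism rquot -> S} := rquot_lift_fun.

End Lift.
End Quotient.

Arguments rproj {R} I x.

(* A point of Spec R. *)
Record prime_ideal (R : comPzRingType) := PrimeIdeal {
  prime_ideal_val :> ideal R;
  prime_ideal1 : ~ prime_ideal_val 1;
  prime_idealM : forall x y,
    prime_ideal_val (x * y) -> prime_ideal_val x \/ prime_ideal_val y
}.

Section ResidueField.
Variables (R : comPzRingType) (p : prime_ideal R).

Definition prime_quot := rquot p.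

HB.instance Definition _ := GRing.ComPzRing.on prime_quot.

Lemma prime_quot1_neq0 : (1 : prime_quot) != 0.
Proof.
apply/eqP; rewrite -(rmorph1 (rproj p)) => /rproj_eq0.
exact: prime_ideal1.
Qed.

HB.instance Definition _ :=
  GRing.PzSemiRing_isNonZero.Build prime_quot prime_quot1_neq0.

Definition pq_unit : {pred prime_quot} :=
  fun x => `[< exists y, y * x = 1 >].
Definition pq_inv (x : prime_quot) : prime_quot :=
  if pselect (exists y, y * x = 1) is left e then projT1 (cid e) else x.

Lemma pq_mulVx : {in pq_unit, left_inverse 1 pq_inv *%R}.
Proof.
move=> x /asboolP xU; rewrite /pq_inv.
by case: pselect => // e; apply: (projT2 (cid e)).
Qed.

Lemma pq_unitPl x y : y * x = 1 -> pq_unit x.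
Proof. by move=> yx; apply/asboolP; exists y. Qed.

Lemma pq_inv_out : {in [predC pq_unit], pq_inv =1 id}.
Proof.
move=> x /asboolP xU; rewrite /pq_inv.
by case: pselect.
Qed.

HB.instance Definition _ := GRing.ComNzRing_hasMulInverse.Build prime_quot
  pq_mulVx pq_unitPl pq_inv_out.

Lemma pq_idomain (x y : prime_quot) : x * y = 0 -> (x == 0) || (y == 0).
Proof.
have [a ->] := rproj_surj x; have [b ->] := rproj_surj y.
rewrite -rmorphM => /rproj_eq0 /prime_idealM [] /rproj_eq0 ->.
  by rewrite eqxx.
by rewrite eqxx orbT.
Qed.

HB.instance Definition _ :=
  GRing.ComUnitRing_isIntegral.Build prime_quot pq_idomain.

Definition residue_field : fieldType := {fraction prime_quot}.

Definition to_residue : {rmorphism R -> residue_field} :=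
  @FracField.tofrac prime_quot \o (rproj p : R -> prime_quot).

End ResidueField.

Section Localization.
Variables (R : comPzRingType) (f : R).

(* (a, k) stands for the fraction a / f ^ k. *)
Definition lequiv (x y : R * nat) : bool :=
  `[< exists k, f ^+ k * (x.1 * f ^+ y.2 - y.1 * f ^+ x.2) = 0 >].

Lemma lequiv_refl : reflexive lequiv.
Proof. by move=> x; apply/asboolP; exists 0%N; rewrite subrr mulr0. Qed.

Lemma lequiv_sym : ssrbool.symmetric lequiv.
Proof.
move=> x y; apply/asboolP/asboolP => -[k e]; exists k;
  by rewrite -opprB mulrN e oppr0.
Qed.

Lemma lequiv_trans : transitive lequiv.
Proof.
move=> [b n] [a m] [c q] /asboolP [k /= ab] /asboolP [l /= bc].
apply/asboolP; exists (k + l + n)%N => /=.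
have -> : f ^+ (k + l + n) * (a * f ^+ q - c * f ^+ m) =
  f ^+ (l + q) * (f ^+ k * (a * f ^+ n - b * f ^+ m)) +
  f ^+ (k + m) * (f ^+ l * (b * f ^+ q - c * f ^+ n)).
  by rewrite !exprD; ring.
by rewrite ab bc !mulr0 addr0.
Qed.

Canonical lequiv_equiv := EquivRel lequiv lequiv_refl lequiv_sym lequiv_trans.

Definition loc := {eq_quot lequiv}.

HB.instance Definition _ : EqQuotient (R * nat)%type lequiv loc := EqQuotient.on loc.
HB.instance Definition _ := Choice.on loc.

Lemma locP (x y : R * nat) :
  reflect (exists k, f ^+ k * (x.1 * f ^+ y.2 - y.1 * f ^+ x.2) = 0)
          (\pi_loc x == \pi_loc y).
Proof. by rewrite eqmodE; apply: asboolP. Qed.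

Lemma loc_eq x y k : f ^+ k * (x.1 * f ^+ y.2 - y.1 * f ^+ x.2) = 0 ->
  \pi_loc x = \pi_loc y.
Proof. by move=> e; apply/eqP/locP; exists k. Qed.

Lemma loc_repr x : exists k,
  f ^+ k * (x.1 * f ^+ (repr (\pi_loc x)).2 - (repr (\pi_loc x)).1 * f ^+ x.2)
    = 0.
Proof. by apply/locP; rewrite reprK. Qed.

Definition pre_opp (x : R * nat) := (- x.1, x.2).
Definition pre_add (x y : R * nat) :=
  (x.1 * f ^+ y.2 + y.1 * f ^+ x.2, (x.2 + y.2)%N).
Definition pre_mul (x y : R * nat) := (x.1 * y.1, (x.2 + y.2)%N).

Definition loc_zero : loc := lift_cst loc (0, 0%N).
Definition loc_one : loc := lift_cst loc (1, 0%N).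
Definition loc_opp := lift_op1 loc pre_opp.
Definition loc_add := lift_op2 loc pre_add.
Definition loc_mul := lift_op2 loc pre_mul.

Canonical loc_zero_morph := PiConst loc_zero.
Canonical loc_one_morph := PiConst loc_one.

Lemma pi_loc_opp : {morph \pi : x / pre_opp x >-> loc_opp x}.
Proof.
move=> x; unlock loc_opp; have [k] := loc_repr x.
case: x (repr (\pi_loc x)) => [a m] [a' m'] /= e.
by apply: (@loc_eq _ _ k); rewrite /= !mulNr -opprD mulrN e oppr0.
Qed.
Canonical loc_opp_morph := PiMorph1 pi_loc_opp.

Lemma pi_loc_add : {morph \pi : x y / pre_add x y >-> loc_add x y}.
Proof.
move=> x y; unlock loc_add; have [k] := loc_repr x; have [l] := loc_repr y.
case: x (repr (\pi_loc x)) => [a m] [a' m'].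
case: y (repr (\pi_loc y)) => [b n] [b' n'] /= eb ea.
apply: (@loc_eq _ _ (k + l)) => /=.
transitivity
  (f ^+ (l + n + n') * (f ^+ k * (a * f ^+ m' - a' * f ^+ m)) +
   f ^+ (k + m + m') * (f ^+ l * (b * f ^+ n' - b' * f ^+ n))).
  by rewrite !exprD; ring.
by rewrite ea eb !mulr0 addr0.
Qed.
Canonical loc_add_morph := PiMorph2 pi_loc_add.

Lemma pi_loc_mul : {morph \pi : x y / pre_mul x y >-> loc_mul x y}.
Proof.
move=> x y; unlock loc_mul; have [k] := loc_repr x; have [l] := loc_repr y.
case: x (repr (\pi_loc x)) => [a m] [a' m'].
case: y (repr (\pi_loc y)) => [b n] [b' n'] /= eb ea.
apply: (@loc_eq _ _ (k + l)) => /=.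
transitivity
  (f ^+ (l + n') * b * (f ^+ k * (a * f ^+ m' - a' * f ^+ m)) +
   f ^+ (k + m) * a' * (f ^+ l * (b * f ^+ n' - b' * f ^+ n))).
  by rewrite !exprD; ring.
by rewrite ea eb !mulr0 addr0.
Qed.
Canonical loc_mul_morph := PiMorph2 pi_loc_mul.

Lemma loc_addA : associative loc_add.
Proof.
move=> x y z; rewrite -[x]reprK -[y]reprK -[z]reprK !piE.
by apply: (@loc_eq _ _ 0) => /=; rewrite !exprD; ring.
Qed.

Lemma loc_addC : commutative loc_add.
Proof.
move=> x y; rewrite -[x]reprK -[y]reprK !piE.
by apply: (@loc_eq _ _ 0) => /=; rewrite !exprD; ring.
Qed.

Lemma loc_add0 : left_id loc_zero loc_add.
Proof.
move=> x; rewrite -[x]reprK !piE.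
by apply: (@loc_eq _ _ 0) => /=; rewrite !exprD; ring.
Qed.

Lemma loc_addN : left_inverse loc_zero loc_opp loc_add.
Proof.
move=> x; rewrite -[x]reprK !piE.
by apply: (@loc_eq _ _ 0) => /=; rewrite !exprD; ring.
Qed.

HB.instance Definition _ :=
  GRing.isZmodule.Build loc loc_addA loc_addC loc_add0 loc_addN.

Lemma loc_mulA : associative loc_mul.
Proof.
move=> x y z; rewrite -[x]reprK -[y]reprK -[z]reprK !piE.
by apply: (@loc_eq _ _ 0) => /=; rewrite !exprD; ring.
Qed.

Lemma loc_mulC : commutative loc_mul.
Proof.
move=> x y; rewrite -[x]reprK -[y]reprK !piE.
by apply: (@loc_eq _ _ 0) => /=; rewrite !exprD; ring.
Qed.

Lemma loc_mul1 : left_id loc_one loc_mul.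
Proof.
move=> x; rewrite -[x]reprK !piE.
by apply: (@loc_eq _ _ 0) => /=; rewrite !exprD; ring.
Qed.

Lemma loc_mulDl : left_distributive loc_mul loc_add.
Proof.
move=> x y z; rewrite -[x]reprK -[y]reprK -[z]reprK !piE.
by apply: (@loc_eq _ _ 0) => /=; rewrite !exprD; ring.
Qed.

HB.instance Definition _ :=
  GRing.Zmodule_isComPzRing.Build loc loc_mulA loc_mulC loc_mul1 loc_mulDl.

Definition loc_frac (a : R) (k : nat) : loc := \pi_loc (a, k).

Definition loc_map (a : R) : loc := loc_frac a 0.

Lemma loc_map_is_zmod_morphism : zmod_morphism loc_map.
Proof.
move=> x y; rewrite /loc_map /loc_frac.
have -> (u v : loc) : u - v = loc_add u (loc_opp v) by [].
rewrite !piE.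
by apply: (@loc_eq _ _ 0) => /=; ring.
Qed.

Lemma loc_map_is_monoid_morphism : monoid_morphism loc_map.
Proof.
split=> [|x y]; rewrite /loc_map /loc_frac.
  have -> : (1 : loc) = loc_one by [].
  by rewrite piE.
have -> (u v : loc) : u * v = loc_mul u v by [].
by rewrite !piE.
Qed.

HB.instance Definition _ :=
  GRing.isZmodMorphism.Build R loc loc_map loc_map_is_zmod_morphism.
HB.instance Definition _ :=
  GRing.isMonoidMorphism.Build R loc loc_map loc_map_is_monoid_morphism.

Definition loc_inv : loc := loc_frac 1 1.

Lemma loc_mapV : loc_map f * loc_inv = 1.
Proof.
rewrite /loc_map /loc_inv /loc_frac.
have -> (u v : loc) : u * v = loc_mul u v by [].
have -> : (1 : loc) = loc_one by [].
rewrite !piE.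
by apply: (@loc_eq _ _ 0) => /=; ring.
Qed.

Lemma loc_fracE a k : loc_frac a k = loc_map a * loc_inv ^+ k.
Proof.
elim: k => [|k IHk]; first by rewrite mulr1.
rewrite exprSr mulrA -IHk /loc_inv /loc_frac.
have -> (u v : loc) : u * v = loc_mul u v by [].
rewrite !piE.
by apply: (@loc_eq _ _ 0) => /=; rewrite addn1; ring.
Qed.

Lemma loc_surj (x : loc) : exists a k, x = loc_map a * loc_inv ^+ k.
Proof.
exists (repr x).1, (repr x).2.
by rewrite -loc_fracE /loc_frac -surjective_pairing reprK.
Qed.

Lemma loc_map_eq0 a : loc_map a = 0 <-> exists k, f ^+ k * a = 0.
Proof.
rewrite -[in X in _ = X](rmorph0 loc_map); split=> [/eqP/locP|] [k] /=.
  by rewrite !mulr1 subr0 => e; exists k.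
by move=> e; apply: (@loc_eq _ _ k); rewrite /= !mulr1 subr0.
Qed.

End Localization.

Section LinSpan.
Variables (k : fieldType) (V : lmodType k).

Definition lin_span (S : V -> Prop) (z : V) : Prop :=
  exists (m : nat) (a : 'I_m -> k) (s : 'I_m -> V),
    (forall i, S (s i)) /\ z = \sum_(i < m) a i *: s i.

(* For a subspace W, the classes of the v i form a k-basis of V / W. *)
Definition basis_modulo (W : V -> Prop) (mu : nat) (v : 'I_mu -> V) : Prop :=
  (forall a : 'I_mu -> k, W (\sum_(i < mu) a i *: v i) -> forall i, a i = 0) /\
  (forall z, exists a : 'I_mu -> k, W (z - \sum_(i < mu) a i *: v i)).

End LinSpan.

(* U (x)_B k is the quotient of the free k-module on the set U by
   tensor_kernel; << u >> represents u (x) 1. *)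
Section BaseChange.
Variables (B U : comPzRingType) (k : fieldType).
Variables (f : {rmorphism B -> U}) (g : {rmorphism B -> k}).

Definition tensor_relation (z : {freeg U / k}) : Prop :=
  (exists u v, z = << u + v >> - << u >> - << v >>) \/
  (exists b u, z = << f b * u >> - g b *: << u >>).

Definition tensor_kernel : {freeg U / k} -> Prop := lin_span tensor_relation.

Definition tensor_basis (mu : nat) (u : 'I_mu -> U) : Prop :=
  basis_modulo tensor_kernel (fun i => << u i >>).

End BaseChange.

Section OrderIdeals.
Variable n : nat.

Record term_ordering := TermOrdering {
  tord :> rel 'X_{1..n};
  tord_total : total tord;
  tord_anti : ssrbool.antisymmetric tord;
  tord_trans : transitive tord;
  tord_ge1 : forall t, tord 0%MM t;
  tord_mul : forall s t u, tord s t -> tord (u + s)%MM (u + t)%MM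
}.

(* An order ideal {o_1, ..., o_mu} and its border {beta_1, ..., beta_nu}, both
   enumerated.  Terms are written additively, as exponent vectors. *)
Record order_ideal (mu nu : nat) := OrderIdeal {
  oi_terms : mu.-tuple 'X_{1..n};
  oi_border : nu.-tuple 'X_{1..n};
  oi_terms_uniq : uniq oi_terms;
  oi_border_uniq : uniq oi_border;
  oi_nonempty : (0 < mu)%N;
  oi_divclosed : forall s t : 'X_{1..n},
    t \in oi_terms -> (s <= t)%MM -> s \in oi_terms;
  oi_borderP : forall t : 'X_{1..n},
    t \in oi_border <->
    (exists (k : 'I_n) (s : 'X_{1..n}),
        s \in oi_terms /\ t = (U_(k) + s)%MM) /\ t \notin oi_terms
}.

Variables (mu nu : nat) (O : order_ideal mu nu).

Definition is_corner (t : 'X_{1..n}) : Prop :=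
  t \notin oi_terms O /\
  (forall s : 'X_{1..n}, s \notin oi_terms O -> (s <= t)%MM -> s = t).

Definition is_cornercut (sigma : term_ordering) : Prop :=
  forall b t, is_corner b -> t \in oi_terms O -> sigma t b && (t != b).

End OrderIdeals.

Section BorderBasisScheme.
Variables (K : fieldType) (n mu nu : nat) (O : order_ideal n mu nu).

(* The coordinate ring K[c_ij | i < mu, j < nu]. *)
Definition coord (a b : nat) (i : 'I_a) (j : 'I_b) : {mpoly K[a * b]} :=
  'X_(mxvec_index i j).

Definition formal_mult (k : 'I_n) : 'M[{mpoly K[mu * nu]}]_mu :=
  \matrix_(i, m)
    let t := (U_(k) + tnth (oi_terms O) m)%MM in
    if [pick j | tnth (oi_border O) j == t] is Some j then coord i j
    else (tnth (oi_terms O) i == t)%:R.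

Definition I_border_scheme : ideal {mpoly K[mu * nu]} :=
  ideal_gen (fun f => exists (k l : 'I_n) (i j : 'I_mu),
    f = (formal_mult k *m formal_mult l - formal_mult l *m formal_mult k) i j).

End BorderBasisScheme.

Record lin_change (K : fieldType) (n : nat) := LinChange {
  lc_map :> {lrmorphism {mpoly K[n]} -> {mpoly K[n]}};
  lc_bij : bijective lc_map;
  lc_linear : forall i : 'I_n, (msize (lc_map 'X_i) <= 2)%N
}.

(* poi_sel enumerates those border terms of the order ideal whose images form
   the pseudo border: all of them in the first case of poi_kind, and the
   corners in the second one. *)
Record pseudo_order_ideal (K : fieldType) (n mu alpha : nat) :=
  PseudoOrderIdeal {
  poi_lc : lin_change K n;
  poi_nu : nat;
  poi_oi : order_ideal n mu poi_nu;
  poi_sel : 'I_alpha -> 'I_poi_nu;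
  poi_sel_inj : injective poi_sel;
  poi_kind :
    (forall t, (exists j, tnth (oi_border poi_oi) (poi_sel j) = t) <->
               t \in oi_border poi_oi)
    \/
    (forall t, (exists j, tnth (oi_border poi_oi) (poi_sel j) = t) <->
               is_corner poi_oi t)
    /\ (exists sigma : term_ordering n, is_cornercut poi_oi sigma)
}.

Section PseudoOrderIdeal.
Variables (K : fieldType) (n mu alpha : nat).
Variable P : pseudo_order_ideal K n mu alpha.

Definition poi_terms : 'rV[{mpoly K[n]}]_mu :=
  \row_i poi_lc P 'X_[tnth (oi_terms (poi_oi P)) i].

Definition poi_border : 'rV[{mpoly K[n]}]_alpha :=
  \row_j poi_lc P 'X_[tnth (oi_border (poi_oi P)) (poi_sel P j)].

(* The inclusion c_ij |-> c_(i, sel j) of the coordinates attached to the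
   pseudo border into those attached to the whole border. *)
Definition coord_incl :
    {rmorphism {mpoly K[mu * alpha]} -> {mpoly K[mu * poi_nu P]}} :=
  comp_mpoly [tuple mxvec (\matrix_(i, j) coord K i (poi_sel P j)) 0 v
             | v < mu * alpha].

(* If the pseudo border consists of images of corners, this is I(B_O)
   intersected with the subring generated by the coordinates at the corners.
   If it is the image of the whole border, coord_incl merely renumbers the
   coordinates and this is I(B_O). *)
Definition I_scheme : ideal {mpoly K[mu * alpha]} :=
  ideal_comap coord_incl (I_border_scheme K (poi_oi P)).

Definition B_ring : comPzRingType := rquot I_scheme.

(* K[x_1, ..., x_n, c_ij] is represented as K[c_ij][x_1, ..., x_n]. *)
Definition poly_lift :
    {rmorphism {mpoly K[n]} -> {mpoly {mpoly K[mu * alpha]}[n]}} :=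
  map_mpoly (mpolyC (mu * alpha) (R := K)).

Definition generic_basis (j : 'I_alpha) : {mpoly {mpoly K[mu * alpha]}[n]} :=
  poly_lift (poi_border 0 j) -
  \sum_(i < mu) (coord K i j)%:MP * poly_lift (poi_terms 0 i).

Definition I_univ : ideal {mpoly {mpoly K[mu * alpha]}[n]} :=
  ideal_gen (fun f =>
    (exists a, I_scheme a /\ f = a%:MP) \/ (exists j, f = generic_basis j)).

Definition U_ring : comPzRingType := rquot I_univ.

Definition poly_to_U : {rmorphism {mpoly K[n]} -> U_ring} :=
  rproj I_univ \o poly_lift.

Definition coord_to_U : {rmorphism {mpoly K[mu * alpha]} -> U_ring} :=
  rproj I_univ \o mpolyC n (R := {mpoly K[mu * alpha]}).

Lemma coord_to_U_eq0 a : I_scheme a -> coord_to_U a = 0.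
Proof.
by move=> Ia; apply/rproj_eq0/mem_ideal_gen; left; exists a.
Qed.

Definition B_to_U : {rmorphism B_ring -> U_ring} := rquot_lift coord_to_U_eq0.

Definition const_to_B : {rmorphism K -> B_ring} :=
  rproj I_scheme \o mpolyC (mu * alpha) (R := K).

(* The ideal of F[x_1, ..., x_n] corresponding to an F-valued point of
   Spec B. *)
Definition ideal_at (F : fieldType) (u : {rmorphism B_ring -> F}) :
    ideal {mpoly F[n]} :=
  ideal_gen (fun f => exists j,
    f = map_mpoly (u \o rproj I_scheme) (generic_basis j)).

End PseudoOrderIdeal.

Section LocalizedScheme.
Variables (K : fieldType) (n mu alpha : nat).
Variable P : pseudo_order_ideal K n mu alpha.
Variable M : 'M[{mpoly K[mu * alpha]}]_mu.

(* The localization of B_P at det M. *)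
Definition B_det : comPzRingType := loc (rproj (I_scheme P) (\det M)).

Definition B_to_B_det : {rmorphism B_ring P -> B_det} := loc_map _.

Definition coord_to_B_det : {rmorphism {mpoly K[mu * alpha]} -> B_det} :=
  B_to_B_det \o rproj (I_scheme P).

(* invmx needs a nonzero ring with decidable units, hence the adjugate. *)
Definition inv_in_B_det : 'M[B_det]_mu :=
  loc_inv (rproj (I_scheme P) (\det M)) *: map_mx coord_to_B_det (\adj M).

Lemma mulmx_inv_in_B_det : map_mx coord_to_B_det M *m inv_in_B_det = 1%:M.
Proof.
rewrite /inv_in_B_det -scalemxAr -map_mxM mul_mx_adj map_scalar_mx.
by rewrite scale_scalar_mx mulrC loc_mapV.
Qed.

Lemma inv_in_B_det_mulmx : inv_in_B_det *m map_mx coord_to_B_det M = 1%:M.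
Proof.
rewrite /inv_in_B_det -scalemxAl -map_mxM mul_adj_mx map_scalar_mx.
by rewrite scale_scalar_mx mulrC loc_mapV.
Qed.

End LocalizedScheme.

Section Transition.
Variables (K : fieldType) (n mu alpha alpha' : nat).
Variable P : pseudo_order_ideal K n mu alpha.
Variable P' : pseudo_order_ideal K n mu alpha'.

(* The points of B_(P, P'). *)
Definition in_overlap (p : prime_ideal (B_ring P)) : Prop :=
  tensor_basis (B_to_U P) (to_residue p)
    (fun i => poly_to_U P (poi_terms P' 0 i)).

(* F-valued points of the two schemes, over the same embedding of K in F,
   that correspond to the same ideal of F[x_1, ..., x_n]. *)
Definition same_ideal (F : fieldType) (u : {rmorphism B_ring P -> F})
    (v : {rmorphism B_ring P' -> F}) : Prop :=
  (forall a : K, u (const_to_B P a) = v (const_to_B P' a)) /\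
  (forall f, ideal_at u f <-> ideal_at v f).

(* Scheme points are compared through field-valued points lying over them. *)
Definition same_ideal_pt (p : prime_ideal (B_ring P))
    (p' : prime_ideal (B_ring P')) : Prop :=
  exists (F : fieldType) (u : {rmorphism B_ring P -> F})
         (v : {rmorphism B_ring P' -> F}),
    [/\ forall b, u b = 0 <-> p b, forall b, v b = 0 <-> p' b
      & same_ideal u v].

Variables (MC : 'M[{mpoly K[mu * alpha]}]_mu).
Variables (NC : 'M[{mpoly K[mu * alpha]}]_(mu, alpha')).
Variables (MD : 'M[{mpoly K[mu * alpha']}]_mu).

(* Phi is the K-algebra homomorphism d_ij |-> (M_C^-1 N_C)_ij, and it induces
   the identification of points that correspond to the same ideal: both for
   points with values in an arbitrary extension field F of K (where lying in
   the open subset means factoring through the localization) and for the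
   points of the underlying spaces (where the point of Spec (B_P)_(det M_C)
   over p is the extension of p). *)
Definition is_transition (Phi : {rmorphism B_det P' MD -> B_det P MC}) : Prop :=
  [/\ forall a : K, Phi (coord_to_B_det P' MD a%:MP) =
                    coord_to_B_det P MC a%:MP,
      map_mx (Phi \o coord_to_B_det P' MD) (\matrix_(i, j) coord K i j) =
        inv_in_B_det P MC *m map_mx (coord_to_B_det P MC) NC,
      forall (F : fieldType) (u : {rmorphism B_ring P -> F})
             (v : {rmorphism B_ring P' -> F}),
        same_ideal u v <->
        (forall a : K, u (const_to_B P a) = v (const_to_B P' a)) /\
        exists w : {rmorphism B_det P MC -> F},
          u =1 w \o B_to_B_det P MC /\ v =1 w \o Phi \o B_to_B_det P' MD
    & forall (p : prime_ideal (B_ring P)) (p' : prime_ideal (B_ring P')),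
        in_overlap p ->
        (same_ideal_pt p p' <->
         forall b, p' b <->
           ideal_gen (fun y => exists2 c, p c & y = B_to_B_det P MC c)
             (Phi (B_to_B_det P' MD b)))].

End Transition.

(* Main.v *)
From HB Require Import structures.
From mathcomp Require Import all_boot all_algebra fraction.
From mathcomp Require Import boolp.
From mathcomp Require Import ssrcomplements freeg mpoly.
Require Import Defs.

Set Implicit Arguments.
Unset Strict Implicit.
Unset Printing Implicit Defensive.

Import GRing.Theory.

Local Open Scope ring_scope.

(** Everything rests on the universal property of [B_P].  The universal family
    [U_P] is free over [B_P] with basis [P] ([U_basis]).  Conversely, suppose
    that [P] is an [R]-basis of an [R]-algebra over [K[x_1, ..., x_n]], and
    that [b P = P D] in it.  Then [c_ij |-> D_ij] kills the ideal of the
    scheme, because multiplications by the indeterminates commute and have the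
    specialized formal multiplication matrices ([coordinates_kill_scheme]).
    Both parts of the theorem are then changes of basis.

    In the freeness, [P] spans because every border term has a relation
    expressing it through [P]; for a cornercut only the corners come with one,
    and the other border terms are treated by an induction along the term
    ordering ([cornercut_border_ind]).  It is independent because
    [K[x_1, ..., x_n]] acts through commuting matrices on the free module with
    basis the order ideal over the coordinate ring of the border basis scheme
    ([U_independent]).

    Part (a).  Freeness survives the base change to a residue field, where
    [P' = P M_C] has the specialized matrix [M_C] as its coordinates; it is a
    basis if and only if [det M_C] does not vanish ([in_overlap_det]).

    Part (b).  After inverting [det M_C] the universal family has [P'] as a
    second basis, and [b P' = P N_C = P' (M_C^-1 N_C)]; the universal property
    of [B_P'] yields the homomorphism [Phi] with [D |-> M_C^-1 N_C].  Pushed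
    along [Phi], the equalities [P = P' M_D] and [b P = P' N_D] become
    [M_C Phi(M_D) = 1] and [Phi(N_D) = Phi(M_D) C].  The first makes
    [Phi(det M_D)] invertible and the second says that [Phi] sends
    [M_D^-1 N_D] back to [C] ([transition_exists], [transition_cancel]).
    An ideal [I] given by an [F]-valued point of [B_P] and by one of [B_P']
    has both [P] and [P'] as bases of [F[x_1, ..., x_n] / I], so the same
    computation there relates the two systems of coordinates
    ([same_ideal_factors]), and conversely ([factors_same_ideal]). *)

(** * Evaluation of polynomials and homomorphisms out of localizations *)

Section PolynomialEvaluation.
Variables (R : comNzRingType) (S : pzRingType) (n : nat).
Variables (f : {rmorphism R -> S}) (h : 'I_n -> S).
Hypothesis comm_h : forall i j, GRing.comm (h i) (h j).
Hypothesis comm_f : forall r i, GRing.comm (f r) (h i).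

Let eval_monomial (m : 'X_{1..n}) : S := \prod_(i < n) h i ^+ m i.

Let peval (p : {mpoly R[n]}) : S :=
  \sum_(m <- msupp p) f p@_m * eval_monomial m.

Let pevalE p k : (msize p <= k)%N ->
  peval p = \sum_(m : 'X_{1..n < k}) f p@_m * eval_monomial m.
Proof.
move=> le_pk; pose I : subFinType _ := 'X_{1..n < k}.
rewrite /peval (big_mksub I) ?msupp_uniq //=; last first.
  by move=> m /msize_mdeg_lt /leq_trans; apply.
rewrite big_rmcond //= => m /memN_msupp_eq0 ->.
by rewrite raddf0 mul0r.
Qed.

Let peval_is_zmod_morphism : zmod_morphism peval.
Proof.
move=> p q; pose k := maxn (msize (p - q)) (maxn (msize p) (msize q)).
rewrite !(@pevalE _ k) /k ?leq_max ?leqnn ?orbT // -sumrB.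
by apply: eq_bigr => m _; rewrite mcoeffB rmorphB mulrBl.
Qed.

HB.instance Definition _ :=
  GRing.isZmodMorphism.Build {mpoly R[n]} S peval peval_is_zmod_morphism.

Let pevalZX c m : peval (c *: 'X_[m]) = f c * eval_monomial m.
Proof.
have [->|c_neq0] := eqVneq c 0; first by rewrite scale0r !raddf0 mul0r.
by rewrite /peval msuppMCX // big_seq1 mcoeffZ mcoeffX eqxx mulr1.
Qed.

Let eval_monomialD m1 m2 :
  eval_monomial (m1 + m2) = eval_monomial m1 * eval_monomial m2.
Proof.
rewrite -prodrM_comm => [|i j _ _]; last first.
  by apply/commrX/commr_sym/commrX.
by apply: eq_bigr => i _; rewrite mnmDE exprD.
Qed.

Let comm_f_monomial r m : GRing.comm (f r) (eval_monomial m).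
Proof. by apply: commr_prod => i _; apply: commrX. Qed.

Let pevalC c : peval c%:MP = f c.
Proof.
rewrite -alg_mpolyC -mpolyX0 pevalZX [eval_monomial _]big1 ?mulr1 // => i _.
by rewrite mnm0E.
Qed.

Let peval_is_monoid_morphism : monoid_morphism peval.
Proof.
split=> [|p q]; first by rewrite -mpolyC1 pevalC rmorph1.
elim/mpolyind: p => [|c m p _ _ IHp]; first by rewrite mul0r raddf0 mul0r.
rewrite mulrDl !raddfD /= IHp mulrDl; congr (_ + _) => {p IHp}.
elim/mpolyind: q => [|d m' q _ _ IHq]; first by rewrite mulr0 raddf0 mulr0.
rewrite mulrDr !raddfD /= IHq mulrDr; congr (_ + _) => {q IHq}.
rewrite -scalerAl -scalerAr scalerA -mpolyXD !pevalZX rmorphM eval_monomialD.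
by rewrite -!mulrA; congr (_ * _); rewrite !mulrA comm_f_monomial.
Qed.

HB.instance Definition _ :=
  GRing.isMonoidMorphism.Build {mpoly R[n]} S peval peval_is_monoid_morphism.

(** The target may be noncommutative or zero, so that polynomials can be
    evaluated at commuting matrices, and in quotients and localizations that
    may vanish. *)
Lemma mpoly_eval_exists :
  exists g : {rmorphism {mpoly R[n]} -> S},
    (forall c, g c%:MP = f c) /\ (forall i, g 'X_i = h i).
Proof.
exists peval; split=> [c|i] /=; first exact: pevalC.
rewrite -[X in peval X]scale1r pevalZX rmorph1 mul1r.
rewrite [eval_monomial _](big_only1 i) //= => [|j neq_ji _].
  by rewrite mnm1E eqxx expr1.
by rewrite mnm1E eq_sym (negbTE neq_ji) expr0.
Qed.

End PolynomialEvaluation.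

Section PolynomialMaps.
Variables (R : nzRingType) (n : nat).

Lemma mpoly_hom_ext (S : pzRingType) (g1 g2 : {rmorphism {mpoly R[n]} -> S}) :
  (forall c, g1 c%:MP = g2 c%:MP) -> (forall i, g1 'X_i = g2 'X_i) ->
  g1 =1 g2.
Proof.
move=> eqC eqX p; rewrite (mpolyE p) !rmorph_sum; apply: eq_bigr => m _.
rewrite -mul_mpolyC !rmorphM /= eqC; congr (_ * _).
rewrite mpolyXE_id !rmorph_prod; apply: eq_bigr => i _.
by rewrite !rmorphXn /= eqX.
Qed.

Lemma mpoly_monomials_ind (Q : {mpoly R[n]} -> Prop) :
  Q 0 -> (forall p q, Q p -> Q q -> Q (p + q)) ->
  (forall c m, Q (c%:MP * 'X_[m])) -> forall p, Q p.
Proof.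
move=> Q0 QD QM; elim/mpolyind=> // c m p _ _ Qp.
by apply: QD => //; rewrite -mul_mpolyC; apply: QM.
Qed.

End PolynomialMaps.

Lemma bijective_rmorphism_inv (R S : pzRingType) (f : {rmorphism R -> S}) :
  bijective f -> exists g : {rmorphism S -> R}, cancel f g /\ cancel g f.
Proof.
case=> g fK gK.
have gB := can2_zmod_morphism fK gK.
have gM := can2_monoid_morphism fK gK.
pose mB := GRing.isZmodMorphism.Build S R g gB.
pose mM := GRing.isMonoidMorphism.Build S R g gM.
pose gr : {rmorphism S -> R} := HB.pack g mB mM.
by exists gr.
Qed.

Section LocalizationMaps.
Variables (R : comPzRingType) (d : R).

Lemma loc_clear_denominator (x : loc d) :
  exists a k, x * loc_map d d ^+ k = loc_map d a.
Proof.
have [a [k ->]] := loc_surj x; exists a, k.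
by rewrite -mulrA -exprMn [loc_inv d * _]mulrC loc_mapV expr1n mulr1.
Qed.

Lemma loc_hom_exists (S : comPzRingType) (g : {rmorphism R -> S}) (c : S) :
  g d * c = 1 -> exists w : {rmorphism loc d -> S}, g =1 w \o loc_map d.
Proof.
move=> gdc.
pose w (x : loc d) : S := g (repr x).1 * c ^+ (repr x).2.
have gdcX k : g d ^+ k * c ^+ k = 1 by rewrite -exprMn gdc expr1n.
have wfrac a k : w (loc_frac d a k) = g a * c ^+ k.
  rewrite /w /loc_frac; have [l] := loc_repr d (a, k).
  case: (repr _) => b m /= /(congr1 g).
  rewrite rmorphM rmorphB rmorph0 !rmorphM !rmorphXn => eq0.
  have {}eq0 : g a * g d ^+ m = g b * g d ^+ k.
    apply/eqP; rewrite -subr_eq0 -[_ - _]mul1r -(gdcX l) -mulrA mulrCA.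
    by rewrite eq0 mulr0.
  rewrite -[LHS]mulr1 -(gdcX k) mulrACA -eq0.
  by rewrite [c ^+ m * _]mulrC mulrACA gdcX mulr1.
have fracP x : exists a k, x = loc_frac d a k.
  by have [a [k ->]] := loc_surj x; exists a, k; rewrite loc_fracE.
have fracMX a k l : loc_frac d (a * d ^+ l) (k + l) = loc_frac d a k.
  rewrite !loc_fracE rmorphM rmorphXn exprD [_ ^+ k * _]mulrC mulrA.
  by rewrite -[_ * _ * loc_inv d ^+ l]mulrA -exprMn loc_mapV expr1n mulr1.
have wB : zmod_morphism w.
  move=> x y; have [a [k ->]] := fracP x; have [b [l ->]] := fracP y.
  rewrite -(fracMX a k l) -(fracMX b l k) [(l + k)%N]addnC.
  set a' := a * _; set b' := b * _; set m := (k + l)%N.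
  have -> : loc_frac d a' m - loc_frac d b' m = loc_frac d (a' - b') m.
    by rewrite !loc_fracE rmorphB mulrBl.
  by rewrite !wfrac rmorphB mulrBl.
have wM : monoid_morphism w.
  split=> [|x y]; first by rewrite -(rmorph1 (loc_map d)) wfrac rmorph1 mul1r.
  have [a [k ->]] := fracP x; have [b [l ->]] := fracP y.
  have -> : loc_frac d a k * loc_frac d b l = loc_frac d (a * b) (k + l).
    by rewrite !loc_fracE rmorphM exprD mulrACA.
  by rewrite !wfrac rmorphM exprD mulrACA.
pose mB := GRing.isZmodMorphism.Build (loc d) S w wB.
pose mM := GRing.isMonoidMorphism.Build (loc d) S w wM.
pose wr : {rmorphism loc d -> S} := HB.pack w mB mM.
by exists wr => a; rewrite /= wfrac mulr1.
Qed.

Lemma loc_hom_ext (S : comPzRingType) (g1 g2 : {rmorphism loc d -> S}) :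
  g1 \o loc_map d =1 g2 \o loc_map d -> g1 =1 g2.
Proof.
move=> eq12; have eqV : g1 (loc_inv d) = g2 (loc_inv d).
  rewrite -[LHS]mulr1 -(rmorph1 g2) -(loc_mapV d) rmorphM mulrA.
  rewrite -[g2 (loc_map d d)]eq12 -rmorphM [loc_inv d * _]mulrC loc_mapV.
  by rewrite rmorph1 mul1r.
move=> x; have [a [k ->]] := loc_surj x.
by rewrite !rmorphM !rmorphXn eqV [g1 (loc_map d a)]eq12.
Qed.

End LocalizationMaps.
(** * Bases of algebras over a commutative ring *)

Section ModuleBasis.
Variables (R V : comPzRingType) (f : {rmorphism R -> V}) (mu : nat).

Definition spanned (t : 'rV[V]_mu) (v : V) : Prop :=
  exists a : 'cV[R]_mu, v = (t *m map_mx f a) 0 0.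

Definition module_basis (t : 'rV[V]_mu) : Prop :=
  (forall a : 'cV[R]_mu, t *m map_mx f a = 0 -> a = 0) /\
  (forall v, spanned t v).

Section Span.
Variable t : 'rV[V]_mu.

Lemma spanned0 : spanned t 0.
Proof. by exists 0; rewrite map_mx0 mulmx0 [RHS]mxE. Qed.

Lemma spannedD u v : spanned t u -> spanned t v -> spanned t (u + v).
Proof.
by move=> [a ->] [b ->]; exists (a + b); rewrite map_mxD mulmxDr [RHS]mxE.
Qed.

Lemma spannedZ r v : spanned t v -> spanned t (f r * v).
Proof.
by move=> [a ->]; exists (r *: a); rewrite map_mxZ -scalemxAr [RHS]mxE.
Qed.

Lemma spanned_sum (I : Type) (s : seq I) (F : I -> V) :
  (forall i, spanned t (F i)) -> spanned t (\sum_(i <- s) F i).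
Proof.
by move=> sF; apply: big_ind => //; [exact: spanned0 | exact: spannedD].
Qed.

Lemma spanned_gen i : spanned t (t 0 i).
Proof.
exists (delta_mx i 0); rewrite map_delta_mx mxE (bigD1 i) //=.
rewrite big1 => [|j neq_ji].
  by rewrite mxE !eqxx mulr1 addr0.
by rewrite mxE (negbTE neq_ji) mulr0.
Qed.

Lemma spanned_mul x v :
  (forall i, spanned t (x * t 0 i)) -> spanned t v -> spanned t (x * v).
Proof.
move=> xt [a ->]; rewrite mxE mulr_sumr; apply: spanned_sum => i.
by rewrite mxE mulrA mulrC; apply: spannedZ.
Qed.

Hypothesis tB : module_basis t.

Lemma basis_inj p : injective (fun A : 'M[R]_(mu, p) => t *m map_mx f A).
Proof.
move=> A B eqAB; apply/eqP; rewrite -subr_eq0; apply/eqP/matrixP=> i j.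
rewrite [RHS]mxE; have /matrixP/(_ i 0) : col j (A - B) = 0.
  apply: tB.1; rewrite map_col colE mulmxA map_mxB mulmxBr eqAB subrr.
  by rewrite mul0mx.
by rewrite !mxE.
Qed.

Lemma basis_coordinates p (w : 'rV[V]_p) :
  exists A : 'M[R]_(mu, p), w = t *m map_mx f A.
Proof.
have [a aP] := choice (fun j => tB.2 (w 0 j)).
exists (\matrix_(i, j) a j i 0); apply/rowP=> j.
by rewrite aP !mxE; apply: eq_bigr => i _; rewrite !mxE.
Qed.

End Span.

Lemma basis_transition_inv t (M : 'M[R]_mu) :
  module_basis t -> module_basis (t *m map_mx f M) -> exists N, M *m N = 1%:M.
Proof.
move=> tB tMB; have [N tE] := basis_coordinates tMB t; exists N.
apply: (basis_inj tB) => /=.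
by rewrite map_mxM mulmxA -tE map_scalar_mx rmorph1 mulmx1.
Qed.

Lemma basis_transition t (M N : 'M[R]_mu) :
  M *m N = 1%:M -> module_basis t -> module_basis (t *m map_mx f M).
Proof.
move=> MN tB; split=> [a | v].
  rewrite -mulmxA -map_mxM => /tB.1 Ma0.
  by rewrite -[a]mul1mx -(mulmx1C MN) -mulmxA Ma0 mulmx0.
have [a ->] := tB.2 v; exists (N *m a).
by rewrite -mulmxA -map_mxM mulmxA MN mul1mx.
Qed.

End ModuleBasis.

Section LocalizedBasis.
Variables (R V : comPzRingType) (f : {rmorphism R -> V}) (d : R) (mu : nat).
Variables (floc : {rmorphism loc d -> loc (f d)}).
Hypothesis flocE : floc \o loc_map d =1 loc_map (f d) \o f.

Lemma loc_matrix_clear_denominators p q (A : 'M[loc d]_(p, q)) :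
  exists (k : nat) (B : 'M[R]_(p, q)),
    loc_map d d ^+ k *: A = map_mx (loc_map d) B.
Proof.
have /choice [b bP] : forall ij : 'I_p * 'I_q, exists bk : R * nat,
    A ij.1 ij.2 * loc_map d d ^+ bk.2 = loc_map d bk.1.
  move=> ij; have [b [k bk]] := loc_clear_denominator (A ij.1 ij.2).
  by exists (b, k).
pose N := (\sum_ij (b ij).2)%N.
exists N, (\matrix_(i, j) ((b (i, j)).1 * d ^+ (N - (b (i, j)).2))).
apply/matrixP=> i j; rewrite !mxE rmorphM rmorphXn /= -bP -mulrA -exprD mulrC.
by rewrite subnKC // /N (bigD1 (i, j)) //= leq_addr.
Qed.

(** Once denominators are cleared, a relation over the localization is a
    relation over [R] killed by a power of [d], so independence over [R] makes
    a power of [d] kill its coefficients. *)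
Lemma localized_basis (t : 'rV[V]_mu) :
  module_basis f t -> module_basis floc (map_mx (loc_map (f d)) t).
Proof.
move=> tB.
have map_floc p q (B : 'M[R]_(p, q)) :
    map_mx floc (map_mx (loc_map d) B) = map_mx (loc_map (f d)) (map_mx f B).
  by apply/matrixP=> i j; rewrite !mxE [LHS]flocE.
split=> [a ta0 | v].
  have [k [b abE]] := loc_matrix_clear_denominators a.
  have : map_mx (loc_map (f d)) (t *m map_mx f b) = 0.
    rewrite map_mxM -map_floc -abE map_mxZ -scalemxAr ta0 scaler0 //.
  move=> /matrixP/(_ 0 0); rewrite [LHS]mxE [RHS]mxE => /loc_map_eq0 [l].
  move=> db0; have {}db0 : d ^+ l *: b = 0.
    apply: tB.1; rewrite map_mxZ rmorphXn -scalemxAr.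
    by apply/matrixP=> i j; rewrite !ord1 [LHS]mxE [RHS]mxE.
  have unitX m : loc_inv d ^+ m * loc_map d d ^+ m = 1.
    by rewrite -exprMn [loc_inv d * _]mulrC loc_mapV expr1n.
  rewrite -[a]scale1r -(unitX k) -scalerA abE.
  rewrite -[map_mx _ b]scale1r -(unitX l) -scalerA -rmorphXn -map_mxZ db0.
  by rewrite map_mx0 !scaler0.
have [u [k uE]] := loc_clear_denominator v.
have [b bE] := tB.2 u; exists (loc_inv d ^+ k *: map_mx (loc_map d) b).
have invE : floc (loc_inv d) = loc_inv (f d).
  rewrite -[LHS]mulr1 -(loc_mapV (f d)) mulrA -[loc_map (f d) (f d)]flocE /=.
  by rewrite -rmorphM [loc_inv d * _]mulrC loc_mapV rmorph1 mul1r.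
rewrite map_mxZ map_floc -scalemxAr -map_mxM [RHS]mxE.
have -> : map_mx (loc_map (f d)) (t *m map_mx f b) 0 0 = loc_map (f d) u.
  by rewrite mxE -bE.
rewrite -uE rmorphXn /= invE mulrCA -exprMn [loc_inv _ * _]mulrC loc_mapV.
by rewrite expr1n mulr1.
Qed.

End LocalizedBasis.
(** * Order ideals and cornercuts *)

Section Monomials.
Variable n : nat.
Implicit Types s t m : 'X_{1..n}.

Lemma mnm_ind (Q : 'X_{1..n} -> Prop) :
  Q 0%MM -> (forall k m, Q m -> Q (U_(k) + m)%MM) -> forall m, Q m.
Proof.
move=> Q0 QU m; have [d] := ubnP (mdeg m); elim: d m => // d IHd m.
have [/eqP|] := posnP (mdeg m); first by rewrite mdeg_eq0 => /eqP ->.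
rewrite lt0n mdeg_eq0 => m_neq0 le_md.
have [k mk_neq0] : exists k, m k != 0%N.
  apply/existsP; apply: contraNT m_neq0; rewrite negb_exists => /forallP m0.
  by apply/eqP/mnmP=> k; rewrite mnm0E; apply/eqP; have := m0 k; rewrite negbK.
rewrite -(@submK _ U_(k)%MM m) ?lep1mP // addmC; apply/QU/IHd.
rewrite -ltnS (leq_trans _ le_md) // ltnS.
rewrite -[X in (_ < mdeg X)%N](@submK _ U_(k)%MM m) ?lep1mP //.
by rewrite mdegD mdeg1 addn1.
Qed.

Lemma proper_divisor_step s t : (s <= t)%MM -> s != t ->
  exists (k : 'I_n) (t' : 'X_{1..n}), t = (U_(k) + t')%MM /\ (s <= t')%MM.
Proof.
move=> le_st neq_st.
have [k lt_k] : exists k, (s k < t k)%N.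
  apply/existsP; apply: contraNT neq_st; rewrite negb_exists => /forallP ge_st.
  apply/eqP/mnmP=> k; apply/eqP; rewrite eqn_leq (mnm_lepP le_st) leqNgt.
  exact: ge_st.
have le_kt : (U_(k) <= t)%MM by rewrite lep1mP -lt0n (leq_ltn_trans _ lt_k).
exists k, (t - U_(k))%MM; split; first by rewrite addmC submK.
apply/mnm_lepP=> i; rewrite mnmBE mnm1E.
case: eqVneq => [<-|_]; rewrite ?subn0 ?(mnm_lepP le_st) //.
by rewrite -ltnS subn1 prednK ?(leq_ltn_trans _ lt_k).
Qed.

End Monomials.

Section OrderIdealTheory.
Variables (n mu nu : nat) (O : order_ideal n mu nu).
Implicit Types s t b : 'X_{1..n}.

Lemma order_ideal0 : 0%MM \in oi_terms O.
Proof.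
have o_in := mem_tnth (Ordinal (oi_nonempty O)) (oi_terms O).
by apply: oi_divclosed o_in _; apply/mnm_lepP=> i; rewrite mnm0E.
Qed.

Lemma border_notin t : t \in oi_border O -> t \notin oi_terms O.
Proof. by case/oi_borderP. Qed.

Lemma mul_order_ideal (k : 'I_n) t : t \in oi_terms O ->
  (U_(k) + t)%MM \in oi_terms O \/ (U_(k) + t)%MM \in oi_border O.
Proof.
move=> tO; case: (boolP ((U_(k) + t)%MM \in oi_terms O)) => [|ktO].
  by left.
by right; apply/oi_borderP; split=> //; exists k, t.
Qed.

Lemma notin_multiple s t : (s <= t)%MM ->
  s \notin oi_terms O -> t \notin oi_terms O.
Proof. by move=> le_st; apply: contra => tO; apply: oi_divclosed le_st. Qed.

(** Descend from [t] through proper divisors outside of the order ideal. *)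
Lemma corner_below t : t \notin oi_terms O ->
  exists2 b, is_corner O b & (b <= t)%MM.
Proof.
have [d] := ubnP (mdeg t); elim: d t => // d IHd t le_td tO.
have [t_corner|not_corner] := pselect (is_corner O t).
  by exists t; rewrite ?lepm_refl.
have [s [sO le_st neq_st]] :
    exists s, [/\ s \notin oi_terms O, (s <= t)%MM & s != t].
  apply: contrapT => no_s; apply: not_corner; split=> // s sO le_st.
  by apply/eqP; apply: contrapT => /negP neq_st; apply: no_s; exists s.
have [k [t' [tE le_st']]] := proper_divisor_step le_st neq_st.
have [||b b_corner le_bt'] := IHd t'; last 1 first.
- exists b => //; apply/mnm_lepP=> i.
  by rewrite tE mnmDE (leq_trans (mnm_lepP le_bt' i)) // leq_addl.
- by rewrite -ltnS (leq_trans _ le_td) // tE mdegD mdeg1.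
- exact: notin_multiple sO.
Qed.

(** Divide out a variable [x_k] that keeps the term outside of the order ideal.
    The term is also [x_l s] with [s] in the order ideal, where [x_l] is not
    [x_k]; so [x_k] divides [s], and the quotient is [x_l] times a divisor of
    [s]. *)
Lemma border_not_corner t : t \in oi_border O -> ~ is_corner O t ->
  exists (k : 'I_n) (t' : 'X_{1..n}), t = (U_(k) + t')%MM /\ t' \in oi_border O.
Proof.
move=> tB not_corner; have tO := border_notin tB.
have [b b_corner le_bt] := corner_below tO.
have neq_bt : b != t by apply: contra_notN not_corner => /eqP <-.
have [k [t' [tE le_bt']]] := proper_divisor_step le_bt neq_bt.
have t'O : t' \notin oi_terms O by apply: notin_multiple le_bt' b_corner.1.
exists k, t'; split=> //; apply/oi_borderP; split=> //.
have [[l [s [sO tE']]] _] := (oi_borderP O t).1 tB.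
have neq_lk : l != k.
  apply: contraNneq t'O => eq_lk; suff -> : t' = s by [].
  by apply: (@addmI _ U_(k)%MM); rewrite -tE tE' eq_lk.
have le_ks : (U_(k) <= s)%MM.
  rewrite lep1mP; have /mnmP/(_ k) := tE'; rewrite tE !mnmDE !mnm1E eqxx.
  by rewrite (negbTE neq_lk) add0n => <-.
exists l, (s - U_(k))%MM; split.
  by apply: oi_divclosed sO _; apply: lem_subr.
by apply: (@addmI _ U_(k)%MM); rewrite -tE tE' [RHS]addmC -addmA submK.
Qed.

Section Cornercut.
Variable sigma : term_ordering n.

Let below s t := sigma s t && (s != t).

Let below_mul u s t : below s t -> below (u + s)%MM (u + t)%MM.
Proof.
case/andP=> le_st neq_st; rewrite /below tord_mul //=.
by apply: contra neq_st => /eqP/addmI ->.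
Qed.

Let tord_lepm s t : (s <= t)%MM -> sigma s t.
Proof.
move=> le_st; rewrite -(submK le_st) addmC -[X in sigma X]addm0.
exact/tord_mul/tord_ge1.
Qed.

Let below_trans s t u : below s t -> below t u -> below s u.
Proof.
case/andP=> le_st neq_st /andP[le_tu _]; rewrite /below (tord_trans le_st) //=.
apply: contra neq_st => /eqP eq_su; rewrite eq_su in le_st *.
by apply/eqP/(@tord_anti _ sigma); rewrite le_st.
Qed.

Let border_rank t := #|[set j | below (tnth (oi_border O) j) t]|.

Let border_rank_lt s t : s \in oi_border O -> below s t ->
  (border_rank s < border_rank t)%N.
Proof.
case/tnthP=> j sE lt_st; apply/proper_card/properP; split.
  by apply/subsetP=> i; rewrite !inE => /below_trans; apply.
by exists j; rewrite !inE -sE // /below eqxx andbF.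
Qed.

(** Induction along the term ordering on the finitely many border terms: a
    border term which is not a corner may be treated after a smaller border
    term [t'] of which it is a multiple by a variable [x_k], and after the
    border terms among the products of [x_k] with the order ideal.  The
    latter are smaller too, since in a cornercut every element of the order
    ideal is smaller than every term outside of it. *)
Lemma cornercut_border_ind (Q : 'X_{1..n} -> Prop) :
  is_cornercut O sigma ->
  (forall b, is_corner O b -> Q b) ->
  (forall (k : 'I_n) t', (U_(k) + t')%MM \in oi_border O ->
     t' \in oi_border O -> Q t' ->
     (forall s, s \in oi_terms O -> (U_(k) + s)%MM \in oi_border O ->
        Q (U_(k) + s)%MM) ->
     Q (U_(k) + t')%MM) ->
  forall t, t \in oi_border O -> Q t.
Proof.
move=> cut Qcorner Qstep t; have [d] := ubnP (border_rank t).
elim: d t => // d IHd t le_td tB.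
have [t_corner|t_ncorner] := pselect (is_corner O t); first exact: Qcorner.
have [k [t' [tE t'B]]] := border_not_corner tB t_ncorner.
have lt_rank s : s \in oi_border O -> below s t -> Q s.
  move=> sB lt_st; apply: IHd => //.
  by rewrite -ltnS (leq_trans _ le_td) // ltnS border_rank_lt.
rewrite tE; apply: Qstep; rewrite -?tE //.
  apply: lt_rank => //; rewrite /below tord_lepm ?tE ?lem_addl //=.
  apply/eqP=> /(congr1 mdeg)/eqP; rewrite mdegD mdeg1.
  by rewrite -[X in X == _]add0n eqn_add2r.
move=> s sO ksB; apply: lt_rank => //; rewrite tE; apply: below_mul.
have [b b_corner le_bt'] := corner_below (border_notin t'B).
have /andP[le_sb neq_sb] := cut b s b_corner sO.
rewrite /below (tord_trans le_sb (tord_lepm le_bt')) /=.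
by apply: contraTneq sO => ->; apply: border_notin.
Qed.

End Cornercut.
End OrderIdealTheory.
(** * Algebras satisfying the border relations *)

Section Coordinates.
Variables (K : fieldType) (a b : nat).

Definition coord_mx : 'M[{mpoly K[a * b]}]_(a, b) :=
  \matrix_(i, j) coord K i j.

Lemma coord_hom_exists (R : comPzRingType) (c : {rmorphism K -> R})
    (D : 'M[R]_(a, b)) :
  exists g : {rmorphism {mpoly K[a * b]} -> R},
    (forall x, g x%:MP = c x) /\ map_mx g coord_mx = D.
Proof.
have [| | g [gC gX]] := @mpoly_eval_exists _ _ _ c (mxvec D 0).
- by move=> i j; apply: mulrC.
- by move=> x i; apply: mulrC.
exists g; split=> //; apply/matrixP=> i j.
by rewrite !mxE gX mxvecE.
Qed.

Lemma coord_hom_ext (R : pzRingType)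
    (g1 g2 : {rmorphism {mpoly K[a * b]} -> R}) :
  (forall x, g1 x%:MP = g2 x%:MP) -> map_mx g1 coord_mx = map_mx g2 coord_mx ->
  g1 =1 g2.
Proof.
move=> eqC /matrixP eqX; apply: mpoly_hom_ext => // v.
by case/mxvec_indexP: v => i j; have := eqX i j; rewrite !mxE.
Qed.

End Coordinates.

Section FormalMultiplication.
Variables (K : fieldType) (n mu nu : nat) (O : order_ideal n mu nu).

Lemma formal_mult_term (k : 'I_n) (m m' : 'I_mu) :
  tnth (oi_terms O) m' = (U_(k) + tnth (oi_terms O) m)%MM ->
  col m (formal_mult K O k) = delta_mx m' 0.
Proof.
move=> m'E; apply/colP=> i; rewrite !mxE -m'E /= andbT.
case: pickP => [j /eqP jE | _].
  by have := border_notin (mem_tnth j (oi_border O)); rewrite jE mem_tnth.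
by rewrite (inj_eq (tuple_uniqP _ (oi_terms_uniq O))).
Qed.

Lemma formal_mult_border (k : 'I_n) (m : 'I_mu) (j : 'I_nu) :
  tnth (oi_border O) j = (U_(k) + tnth (oi_terms O) m)%MM ->
  col m (formal_mult K O k) = col j (coord_mx K mu nu).
Proof.
move=> jE; apply/colP=> i; rewrite !mxE -jE /=.
case: pickP => [j' /eqP/(tuple_uniqP _ (oi_border_uniq O)) -> // | no_j].
by have := no_j j; rewrite eqxx.
Qed.

End FormalMultiplication.

Section CoordinateInclusion.
Variables (K : fieldType) (n mu alpha : nat).
Variable P : pseudo_order_ideal K n mu alpha.

Lemma coord_inclC (x : K) : coord_incl P x%:MP = x%:MP.
Proof. by rewrite /coord_incl /= comp_mpolyC. Qed.

Lemma coord_incl_coord i j :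
  coord_incl P (coord K i j) = coord K i (poi_sel P j).
Proof.
rewrite /coord_incl /= {1}/coord comp_mpolyXU -tnth_nth tnth_mktuple.
by rewrite mxvecE mxE.
Qed.

End CoordinateInclusion.

Section BorderRelations.
Variables (K : fieldType) (n mu alpha : nat).
Variable P : pseudo_order_ideal K n mu alpha.
Variables (R V : comPzRingType) (f : {rmorphism R -> V}).
Variables (g : {rmorphism {mpoly K[mu * alpha]} -> R}).
Variables (pi : {rmorphism {mpoly K[n]} -> V}).

(** Such a [V] is an algebra over [K[c_ij][x_1, ..., x_n]] in which the
    polynomials [g_j] vanish. *)
Definition border_relations : Prop :=
  (forall x : K, f (g x%:MP) = pi x%:MP) /\
  map_mx pi (poi_border P) =
    map_mx pi (poi_terms P) *m map_mx f (map_mx g (coord_mx K mu alpha)).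

Local Notation O := (poi_oi P).
Local Notation T := (map_mx pi (poi_terms P)).
(* The coordinates in which the pseudo order ideal consists of terms. *)
Let z : {rmorphism {mpoly K[n]} -> V} := pi \o poi_lc P.

Lemma changed_const (x : K) : poi_lc P x%:MP = x%:MP.
Proof. by rewrite -alg_mpolyC linearZ rmorph1. Qed.

Lemma changed_terms i : T 0 i = z 'X_[tnth (oi_terms O) i].
Proof. by rewrite !mxE. Qed.

Hypothesis rel : border_relations.

(** If only the corners have relations, a border term [x_k t'] that is not a
    corner is rewritten by multiplying an expression of [t'] by [x_k]. *)
Lemma changed_border_spanned t :
  t \in oi_border O -> spanned f T (z 'X_[t]).
Proof.
have term_spanned s : s \in oi_terms O -> spanned f T (z 'X_[s]).
  by case/tnthP=> i ->; rewrite -changed_terms; apply: spanned_gen.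
have sel_spanned t' : (exists j, tnth (oi_border O) (poi_sel P j) = t') ->
    spanned f T (z 'X_[t']).
  case=> j <-; exists (col j (map_mx g (coord_mx K mu alpha))).
  have /rowP/(_ j) := rel.2; rewrite map_col !mxE /z /= => ->.
  by apply: eq_bigr => i _; rewrite !mxE.
case: (poi_kind P) => [selP | [selP [sigma cut]]].
  by move/selP/sel_spanned.
move: t; apply: (cornercut_border_ind cut) => [b /selP/sel_spanned // |].
move=> k t' _ _ t'_spanned IH; rewrite mpolyXD rmorphM.
apply: spanned_mul t'_spanned => i; rewrite changed_terms -rmorphM -mpolyXD.
have /(mul_order_ideal k)[ /term_spanned // | ] := mem_tnth i (oi_terms O).
by apply/IH/mem_tnth.
Qed.

Lemma mul_changed_spanned k v : spanned f T v -> spanned f T (z 'X_k * v).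
Proof.
apply: spanned_mul => i; rewrite changed_terms -rmorphM -mpolyXD.
have /(mul_order_ideal k)[/tnthP[j ->] | ] := mem_tnth i (oi_terms O).
  by rewrite -changed_terms; apply: spanned_gen.
exact: changed_border_spanned.
Qed.

Lemma poly_spanned p : spanned f T (pi p).
Proof.
have [psi [phiK psiK]] := bijective_rmorphism_inv (lc_bij (poi_lc P)).
rewrite -(psiK p); elim/mpoly_monomials_ind: (psi p) => {p} [|p q sp sq|c m].
- by rewrite !rmorph0; apply: spanned0.
- by rewrite !rmorphD; apply: spannedD.
rewrite !rmorphM /= changed_const -rel.1; apply: spannedZ.
elim/mnm_ind: m => [|k m]; last first.
  by rewrite mpolyXD !rmorphM; apply: mul_changed_spanned.
have /tnthP[i ->] := order_ideal0 O.
by have := spanned_gen f T i; rewrite changed_terms.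
Qed.

Section Basis.
Hypothesis TB : module_basis f T.

(** The commutators that define the scheme involve the coordinates of the
    whole border, while [g] gives those of the pseudo border; a basis provides
    the missing ones. *)
Lemma border_coordinates_exist :
  exists g' : {rmorphism {mpoly K[mu * poi_nu P]} -> R},
    [/\ forall x : K, g' x%:MP = g x%:MP,
        \row_j z 'X_[tnth (oi_border O) j] =
          T *m map_mx f (map_mx g' (coord_mx K mu (poi_nu P)))
      & g' \o coord_incl P =1 g].
Proof.
have [D DE] := basis_coordinates TB (\row_j z 'X_[tnth (oi_border O) j]).
have [g' [g'C g'D]] := coord_hom_exists (g \o mpolyC (mu * alpha) (R := K)) D.
exists g'; split=> [x | | ]; [exact: g'C | by rewrite g'D|].
apply: coord_hom_ext => [x | ] /=; first by rewrite coord_inclC g'C.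
have zE j : z 'X_[tnth (oi_border O) j] =
    (T *m map_mx f (map_mx g' (coord_mx K mu (poi_nu P)))) 0 j.
  by rewrite g'D -DE mxE.
apply: (basis_inj TB); rewrite -rel.2; apply/rowP=> j.
transitivity (z 'X_[tnth (oi_border O) (poi_sel P j)]); last by rewrite !mxE.
rewrite zE [LHS]mxE [RHS]mxE; apply: eq_bigr => i _; congr (_ * _).
by rewrite !mxE /= coord_incl_coord.
Qed.

(** Multiplication by [x_k] (up to the change of coordinates) has the
    specialized formal multiplication matrix as its matrix in the basis, and
    multiplications commute; so the commutators specialize to zero. *)
Lemma coordinates_kill_scheme a : I_scheme P a -> g a = 0.
Proof.
have [g' [_ zE g'incl]] := border_coordinates_exist.
have colE p (M : 'M[{mpoly K[mu * poi_nu P]}]_(mu, p)) m :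
    (T *m map_mx f (map_mx g' M)) 0 m =
    (T *m map_mx f (map_mx g' (col m M))) 0 0.
  by rewrite matrix.colE !map_mxM !map_delta_mx mulmxA -matrix.colE [RHS]mxE.
have mulE k : z 'X_k *: T = T *m map_mx f (map_mx g' (formal_mult K O k)).
  apply/rowP=> m; rewrite [LHS]mxE changed_terms -rmorphM -mpolyXD colE.
  have [/tnthP[m' m'E]|/tnthP[j jE]] :=
      mul_order_ideal k (mem_tnth m (oi_terms O)).
    rewrite (formal_mult_term K (esym m'E)) !map_delta_mx -matrix.colE mxE.
    by rewrite changed_terms m'E.
  rewrite (formal_mult_border K (esym jE)) -colE -zE mxE jE //.
have commE k l : map_mx g' (formal_mult K O k *m formal_mult K O l) =
    map_mx g' (formal_mult K O l *m formal_mult K O k).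
  apply: (basis_inj TB); rewrite !map_mxM !mulmxA -!mulE -!scalemxAl -!mulE.
  by rewrite !scalerA mulrC.
move=> [r [b [s [Ss aE]]]].
rewrite -[g a]g'incl /= aE rmorph_sum big1 // => q _.
have [k [l [i [j ->]]]] := Ss q; rewrite rmorphM.
have subE A B : map_mx g' A = map_mx g' B -> g' ((A - B) i j) = 0.
  by move=> /matrixP/(_ i j); rewrite !mxE => eqAB; rewrite rmorphB eqAB subrr.
by rewrite subE ?mulr0 //; apply: commE.
Qed.

End Basis.

End BorderRelations.
(** * The universal family is free *)

Section UniversalProperty.
Variables (K : fieldType) (n mu alpha : nat).
Variable P : pseudo_order_ideal K n mu alpha.

Lemma generic_basis_eval (V : comPzRingType)
    (e : {rmorphism {mpoly {mpoly K[mu * alpha]}[n]} -> V}) j :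
  e (generic_basis P j) =
  map_mx (e \o poly_lift K n mu alpha) (poi_border P) 0 j -
  (map_mx (e \o poly_lift K n mu alpha) (poi_terms P) *m
   map_mx (e \o mpolyC n (R := {mpoly K[mu * alpha]}))
     (coord_mx K mu alpha)) 0 j.
Proof.
rewrite rmorphB; congr (_ - _); first by rewrite [RHS]mxE.
rewrite rmorph_sum [RHS]mxE; apply: eq_bigr => i _.
by rewrite rmorphM mulrC; congr (_ * _); rewrite !mxE.
Qed.

Lemma generic_basis_eval_eq0 (R V : comPzRingType) (f : {rmorphism R -> V})
    (g : {rmorphism {mpoly K[mu * alpha]} -> R})
    (pi : {rmorphism {mpoly K[n]} -> V})
    (e : {rmorphism {mpoly {mpoly K[mu * alpha]}[n]} -> V}) :
  e \o poly_lift K n mu alpha =1 pi ->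
  e \o mpolyC n (R := {mpoly K[mu * alpha]}) =1 f \o g ->
  border_relations P f g pi <-> forall j, e (generic_basis P j) = 0.
Proof.
move=> e_lift e_const.
have eE j : e (generic_basis P j) = map_mx pi (poi_border P) 0 j -
    (map_mx pi (poi_terms P) *m map_mx f (map_mx g (coord_mx K mu alpha))) 0 j.
  rewrite generic_basis_eval !(eq_map_mx _ e_lift) (eq_map_mx _ e_const).
  by rewrite -map_mx_comp.
split=> [[_ rel] j | e0]; first by rewrite eE rel subrr.
split=> [x | ]; last by apply/rowP=> j; apply/eqP; rewrite -subr_eq0 -eE e0.
by rewrite -[RHS]e_lift -[LHS]e_const /= map_mpolyC.
Qed.

Section RelationsToHom.
Variables (R V : comPzRingType) (f : {rmorphism R -> V}).
Variables (g : {rmorphism {mpoly K[mu * alpha]} -> R}).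
Variables (pi : {rmorphism {mpoly K[n]} -> V}).
Hypothesis rel : border_relations P f g pi.

Lemma relations_eval_exists :
  exists e : {rmorphism {mpoly {mpoly K[mu * alpha]}[n]} -> V},
    [/\ forall c, e c%:MP = f (g c), e \o poly_lift K n mu alpha =1 pi
      & forall j, e (generic_basis P j) = 0].
Proof.
have [| | e [eC eX]] := @mpoly_eval_exists _ _ n (f \o g) (fun i => pi 'X_i).
- by move=> i j; apply: mulrC.
- by move=> x i; apply: mulrC.
have e_lift : e \o poly_lift K n mu alpha =1 pi.
  apply: mpoly_hom_ext => [x | i] /=; first by rewrite map_mpolyC eC /= rel.1.
  by rewrite map_mpolyX eX.
exists e; split=> //; exact: (generic_basis_eval_eq0 e_lift eC).1 rel.
Qed.

Lemma U_hom_exists : (forall a, I_scheme P a -> g a = 0) ->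
  exists h : {rmorphism U_ring P -> V},
    h \o poly_to_U P =1 pi /\ h \o coord_to_U P =1 f \o g.
Proof.
move=> g0; have [e [eC e_lift e0]] := relations_eval_exists.
have eI x : I_univ P x -> e x = 0.
  move=> [m [a [s [Ss ->]]]]; rewrite rmorph_sum big1 // => i _.
  rewrite rmorphM; case: (Ss i) => [[c [Ic ->]] | [j ->]].
    by rewrite eC g0 // rmorph0 mulr0.
  by rewrite e0 mulr0.
exists (rquot_lift eI); split=> [p | c].
  rewrite -[RHS]e_lift. exact: (rquot_lift_rproj eI).
rewrite -[RHS]eC; exact: (rquot_lift_rproj eI).
Qed.

End RelationsToHom.

Lemma B_to_U_rproj c : B_to_U P (rproj (I_scheme P) c) = coord_to_U P c.
Proof. exact: (rquot_lift_rproj (@coord_to_U_eq0 _ _ _ _ P)). Qed.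

Lemma U_relations :
  border_relations P (B_to_U P) (rproj (I_scheme P)) (poly_to_U P).
Proof.
have e_const : rproj (I_univ P) \o mpolyC n (R := {mpoly K[mu * alpha]}) =1
    B_to_U P \o rproj (I_scheme P) by move=> a; exact: esym (B_to_U_rproj a).
have e_lift : rproj (I_univ P) \o poly_lift K n mu alpha =1 poly_to_U P by [].
apply/(generic_basis_eval_eq0 e_lift e_const) => j.
by apply/rproj_eq0/mem_ideal_gen; right; exists j.
Qed.

Lemma U_spanned u :
  spanned (B_to_U P) (map_mx (poly_to_U P) (poi_terms P)) u.
Proof.
have [q ->] := rproj_surj u.
elim/mpoly_monomials_ind: q => [|p q sp sq|c m].
- by rewrite rmorph0; apply: spanned0.
- by rewrite rmorphD; apply: spannedD.
have -> : rproj (I_univ P) (c%:MP * 'X_[m]) =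
    B_to_U P (rproj (I_scheme P) c) * poly_to_U P 'X_[m].
  by rewrite rmorphM B_to_U_rproj /= [poly_lift _ _ _ _ _]map_mpolyX.
exact: spannedZ (poly_spanned U_relations _).
Qed.

(** For independence, the polynomial ring over the coordinates acts on the
    free module with basis the order ideal over [K[c_ij] / I], where [c_ij]
    now run over the coordinates of the whole border, by the formal
    multiplication matrices, which commute there.  Evaluation at the basis
    vector of the term [1] sends the terms of the order ideal to the basis
    vectors and annihilates the generators of the ideal defining the
    universal family. *)
Lemma U_independent (a : 'I_mu -> {mpoly K[mu * alpha]}) :
  \sum_i coord_to_U P (a i) * poly_to_U P (poi_terms P 0 i) = 0 ->
  forall i, I_scheme P (a i).
Proof.
pose O := poi_oi P; pose IO := I_border_scheme K O.
pose A k := map_mx (rproj IO) (formal_mult K O k).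
have map_rproj_eq p (M N : 'M_p) : (forall i j, IO ((M - N) i j)) ->
    map_mx (rproj IO) M = map_mx (rproj IO) N.
  move=> IMN; apply/matrixP=> i j; rewrite [LHS]mxE [RHS]mxE; apply/eqP.
  rewrite -subr_eq0 -rmorphB; apply/eqP/rproj_eq0.
  by have := IMN i j; rewrite !mxE.
have commA k l : GRing.comm (A k) (A l).
  change (A k *m A l = A l *m A k); rewrite /A -!map_mxM.
  by apply: map_rproj_eq => i j; apply: mem_ideal_gen; exists k, l, i, j.
pose scalar : {rmorphism rquot IO -> 'M[rquot IO]_mu} := scalar_mx.
have commS r (M : 'M[rquot IO]_mu) : GRing.comm (scalar r) M.
  by apply: esym; apply: scalar_mxC.
(* [E0] evaluates in the changed coordinates, [E] in the original ones. *)
have [|x k|E0 [E0C E0X]] := @mpoly_eval_exists _ _ n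
    (scalar \o (rproj IO \o mpolyC (mu * poi_nu P) (R := K))) A.
- exact: commA.
- exact: commS.
have [psi [phiK psiK]] := bijective_rmorphism_inv (lc_bij (poi_lc P)).
have [k l|x k|E [EC EX]] := @mpoly_eval_exists _ _ n
    (scalar \o (rproj IO \o coord_incl P)) (fun k => E0 (psi 'X_k)).
- by rewrite /GRing.comm -!rmorphM mulrC.
- exact: commS.
have E_psi : E \o poly_lift K n mu alpha =1 E0 \o psi.
  apply: mpoly_hom_ext => [x | i] /=; last by rewrite map_mpolyX EX.
  by rewrite map_mpolyC EC -[in RHS](changed_const P) phiK E0C /= coord_inclC.
have E_lift p : E (poly_lift K n mu alpha (poi_lc P p)) = E0 p.
  by rewrite -[RHS](congr1 E0 (phiK p)); apply: E_psi.
have [m0 m0E] := tnthP _ _ (order_ideal0 O).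
pose e0 : 'cV[rquot IO]_mu := delta_mx m0 0.
have E0_step k t m : tnth (oi_terms O) m = t ->
    E0 'X_[t] *m e0 = delta_mx m 0 ->
    E0 'X_[U_(k) + t] *m e0 = map_mx (rproj IO) (col m (formal_mult K O k)).
  move=> mE E0t; rewrite mpolyXD rmorphM E0X map_col matrix.colE -E0t.
  by rewrite mulmxA.
have E0_term m : E0 'X_[tnth (oi_terms O) m] *m e0 = delta_mx m 0.
  have [t tE] : exists t, t = tnth (oi_terms O) m by eexists.
  rewrite -tE; elim/mnm_ind: t m tE => [|k t IH] m mE.
    have -> : m = m0 by apply: (tuple_uniqP _ (oi_terms_uniq O)); rewrite -mE.
    by rewrite mpolyX0 rmorph1 mul1mx.
  have /tnthP[m' m'E] : t \in oi_terms O.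
    by apply: oi_divclosed (mem_tnth m _) _; rewrite -mE lem_addl.
  rewrite (E0_step k t m' (esym m'E) (IH _ m'E)).
  by rewrite (@formal_mult_term _ _ _ _ _ _ _ m) -?m'E -?mE // map_delta_mx.
have E0_border j : E0 'X_[tnth (oi_border O) j] *m e0 =
    map_mx (rproj IO) (col j (coord_mx K mu (poi_nu P))).
  have [[k [s [/tnthP[m ->] jE]]] _] := (oi_borderP O _).1 (mem_tnth j _).
  by rewrite jE (E0_step _ _ m) // (formal_mult_border K jE).
have E0_comb (b : 'I_mu -> rquot IO) :
    (\sum_i scalar (b i) * E0 'X_[tnth (oi_terms O) i]) *m e0 = \col_i b i.
  rewrite mulmx_suml; apply/colP=> i; rewrite summxE (bigD1 i) //= big1 => [|l].
    by rewrite -mulmxA E0_term mul_scalar_mx !mxE !eqxx addr0 mulr1.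
  rewrite eq_sym -mulmxA E0_term mul_scalar_mx !mxE => /negbTE ->.
  by rewrite mulr0.
have killed F : I_univ P F -> E F *m e0 = 0.
  move=> [r [b [g [Sg ->]]]]; rewrite rmorph_sum mulmx_suml big1 // => i _.
  rewrite rmorphM -mulmxA; case: (Sg i) => [[c [Ic ->]] | [j ->]].
    rewrite EC /=; have /rproj_eq0 -> : IO (coord_incl P c) by [].
    by rewrite [scalar_mx 0]raddf0 mul0mx mulmx0.
  rewrite /generic_basis mxE rmorphB E_lift rmorph_sum mulmxBl E0_border.
  under eq_bigr => l _ do rewrite mxE rmorphM E_lift EC /=.
  rewrite (E0_comb (fun l => rproj IO (coord_incl P (coord K l j)))).
  suff -> : \col_l rproj IO (coord_incl P (coord K l j)) =
      map_mx (rproj IO) (col (poi_sel P j) (coord_mx K mu (poi_nu P))).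
    by rewrite subrr mulmx0.
  by apply/colP=> l; rewrite !mxE coord_incl_coord.
move=> a0 i; apply/(rproj_eq0 IO).
have : I_univ P (\sum_l (a l)%:MP * poly_lift K n mu alpha (poi_terms P 0 l)).
  apply/rproj_eq0; rewrite rmorph_sum; under eq_bigr => l _ do rewrite rmorphM.
  exact: a0.
move=> /killed; rewrite rmorph_sum.
under eq_bigr => l _ do rewrite mxE rmorphM E_lift EC /=.
rewrite (E0_comb (fun l => rproj IO (coord_incl P (a l)))) => /colP/(_ i).
by rewrite !mxE.
Qed.

Lemma U_basis :
  module_basis (B_to_U P) (map_mx (poly_to_U P) (poi_terms P)).
Proof.
split=> [a Ta0 | u]; last exact: U_spanned.
have [b bE] := choice (fun i => rproj_surj (a i 0)).
suff Ib i : I_scheme P (b i).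
  by apply/colP=> i; rewrite bE mxE; apply/rproj_eq0.
apply: U_independent i => /=; have /matrixP/(_ 0 0) := Ta0.
rewrite [LHS]mxE [RHS]mxE => sum0; rewrite -[RHS]sum0; apply: eq_bigr => i _.
rewrite mulrC; congr (_ * _); first by rewrite [RHS]mxE.
by rewrite [RHS]mxE bE B_to_U_rproj.
Qed.

End UniversalProperty.
(** * Base change to a residue field *)

Section LinearSpan.
Variables (k : fieldType) (V : lmodType k) (S : V -> Prop).

Lemma lin_span_gen v : S v -> lin_span S v.
Proof.
by move=> Sv; exists 1%N, (fun=> 1), (fun=> v); rewrite big_ord1 scale1r.
Qed.

Lemma lin_span0 : lin_span S 0.
Proof.
by exists 0%N, (fun=> 0), (fun=> 0); split=> [[]//|]; rewrite big_ord0.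
Qed.

Lemma lin_spanD u v : lin_span S u -> lin_span S v -> lin_span S (u + v).
Proof.
move=> [m [a [s [Ss ->]]]] [m' [a' [s' [Ss' ->]]]].
exists (m + m')%N,
  (fun i => match split i with inl j => a j | inr j => a' j end),
  (fun i => match split i with inl j => s j | inr j => s' j end).
split=> [i|]; first by case: (split i).
rewrite big_split_ord /=; congr (_ + _); apply: eq_bigr => i _.
  by rewrite (unsplitK (inl i)).
by rewrite (unsplitK (inr i)).
Qed.

Lemma lin_spanZ c v : lin_span S v -> lin_span S (c *: v).
Proof.
move=> [m [a [s [Ss ->]]]]; exists m, (fun i => c * a i), s; split=> //.
by rewrite scaler_sumr; apply: eq_bigr => i _; rewrite scalerA.
Qed.

Lemma lin_span_sum (I : Type) (r : seq I) (F : I -> V) :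
  (forall i, lin_span S (F i)) -> lin_span S (\sum_(i <- r) F i).
Proof.
by move=> SF; apply: big_ind => //; [exact: lin_span0 | exact: lin_spanD].
Qed.

End LinearSpan.

Section FreeModuleMaps.
Variable k : fieldType.

Section FreeGroup.
Variable U : choiceType.
Implicit Type z : {freeg U / k}.

Lemma freegUZ c (u : U) : << c *g u >> = c *: << u >> :> {freeg U / k}.
Proof. by apply/eqP/freeg_eqP=> x; rewrite coeffZ !coeffU mul1r. Qed.

Lemma freeg_combination z : z = \sum_(u <- dom z) coeff u z *: << u >>.
Proof.
by rewrite -[LHS]freeg_sumE; apply: eq_bigr => u _; rewrite freegUZ.
Qed.

Lemma freeg_linear_exists (V : lmodType k) (v : U -> V) :
  exists L : {linear {freeg U / k} -> V}, forall u, L << u >> = v u.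
Proof.
pose L : {freeg U / k} -> V := fglift v.
have LB : zmod_morphism L := lift_is_additive v.
pose mB := GRing.isZmodMorphism.Build _ _ L LB.
pose La : {additive {freeg U / k} -> V} := HB.pack L mB.
have LZ : scalable L.
  move=> c z; have Lsum (F : U -> {freeg U / k}) :
      L (\sum_(u <- dom z) F u) = \sum_(u <- dom z) L (F u).
    exact: (raddf_sum La).
  have -> : c *: z = \sum_(u <- dom z) << c * coeff u z *g u >> by [].
  rewrite Lsum -[in RHS](freeg_sumE z) Lsum scaler_sumr.
  by apply: eq_bigr => u _; rewrite /L !liftU scalerA.
pose mZ := GRing.isScalable.Build k {freeg U / k} V *:%R L LZ.
pose Ll : {linear {freeg U / k} -> V} := HB.pack L mB mZ.
by exists Ll => u; rewrite /= /L liftU scale1r.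
Qed.

End FreeGroup.

Lemma mpoly_linear_exists n (V : lmodType k) (v : 'X_{1..n} -> V) :
  exists L : {linear {mpoly k[n]} -> V}, forall m, L 'X_[m] = v m.
Proof.
have [L0 L0E] := freeg_linear_exists v.
pose L (p : {mpoly k[n]}) : V := L0 (mpoly_val p).
have LB : zmod_morphism L by move=> p q; rewrite /L -raddfB.
have LZ : scalable L by move=> c p; rewrite /L -linearZ.
pose mB := GRing.isZmodMorphism.Build _ _ L LB.
pose mZ := GRing.isScalable.Build k {mpoly k[n]} V *:%R L LZ.
pose Ll : {linear {mpoly k[n]} -> V} := HB.pack L mB mZ.
by exists Ll => m; rewrite /= /L -[RHS]L0E /mpolyX unlock.
Qed.

End FreeModuleMaps.

Section TensorBasis.
Variables (B U : comPzRingType) (k : fieldType) (mu : nat).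
Variables (f : {rmorphism B -> U}) (g : {rmorphism B -> k}).
Variable t : 'rV[U]_mu.
Hypothesis tB : module_basis f t.

Lemma coordinates_exist : exists c : U -> 'cV[B]_mu,
  [/\ forall u, u = (t *m map_mx f (c u)) 0 0, {morph c : u v / u + v},
      forall b u, c (f b * u) = b *: c u
    & forall M : 'M[B]_mu, forall i, c ((t *m map_mx f M) 0 i) = col i M].
Proof.
have [c cE] := choice tB.2.
have c_uniq u a : u = (t *m map_mx f a) 0 0 -> c u = a.
  move=> uE; apply: (basis_inj tB); apply/matrixP=> i j.
  by rewrite !ord1 -cE -uE.
exists c; split=> // [u v | b u | M i]; apply: c_uniq.
- by rewrite map_mxD mulmxDr [RHS]mxE -!cE.
- by rewrite map_mxZ -scalemxAr [RHS]mxE -cE.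
by rewrite matrix.colE map_mxM map_delta_mx mulmxA -matrix.colE [RHS]mxE.
Qed.

(** Modulo the relations of the tensor product, [<< u >>] is the combination
    of the [<< t_i >>] whose coefficients are the images under [g] of the
    coordinates of [u]; so only the kernel of [L] is killed. *)
Lemma tensor_coordinates_exist :
  exists L : {linear {freeg U / k} -> 'cV[k]_mu},
    (forall z, tensor_kernel f g z <-> L z = 0) /\
    forall (M : 'M[B]_mu) i, L << (t *m map_mx f M) 0 i >> = col i (map_mx g M).
Proof.
have [c [cE cD cZ cM]] := coordinates_exist.
have [L LE] := freeg_linear_exists (fun u => map_mx g (c u)).
exists L; split=> [z | M i]; last by rewrite LE cM map_col.
have kerL w : tensor_kernel f g w -> L w = 0.
  move=> [m [a [s [Ss ->]]]]; rewrite linear_sum big1 // => i _.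
  rewrite linearZ; case: (Ss i) => [[u [v ->]] | [b [u ->]]].
    by rewrite !linearB !LE cD map_mxD -addrA -opprD subrr; apply: scaler0.
  by rewrite linearB linearZ /= !LE cZ map_mxZ subrr scaler0.
have tensorD u v : tensor_kernel f g (<< u + v >> - << u >> - << v >>).
  by apply: lin_span_gen; left; exists u, v.
have tensor_sum (I : Type) (r : seq I) (F : I -> U) :
    tensor_kernel f g (<< \sum_(j <- r) F j >> - \sum_(j <- r) << F j >>).
  elim: r => [|j r IH]; rewrite ?big_nil ?big_cons.
    rewrite subr0 -[<< 0 >>]opprK -scaleN1r; apply: lin_spanZ.
    by have := tensorD 0 0; rewrite addr0 subrr sub0r.
  have := lin_spanD (tensorD (F j) (\sum_(i <- r) F i)) IH.
  by rewrite addrA subrK opprD [X in _ -> lin_span _ X]addrA.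
have tensor_gen u :
    tensor_kernel f g (<< u >> - \sum_i L << u >> i 0 *: << t 0 i >>).
  have uE : u = \sum_i f (c u i 0) * t 0 i.
    by rewrite [LHS]cE mxE; apply: eq_bigr => i _; rewrite mxE mulrC.
  rewrite {1}uE; set F := fun i => f (c u i 0) * t 0 i.
  rewrite -[<< _ >>](subrK (\sum_i << F i >>)) -addrA -sumrB.
  apply: lin_spanD; first exact: tensor_sum.
  apply: lin_span_sum => i; apply: lin_span_gen; right.
  by exists (c u i 0), (t 0 i); rewrite LE mxE.
split=> [|Lz0]; first exact: kerL.
have : tensor_kernel f g (z - \sum_i L z i 0 *: << t 0 i >>).
  have -> : z - \sum_i L z i 0 *: << t 0 i >> = \sum_(u <- dom z)
      coeff u z *: (<< u >> - \sum_i L << u >> i 0 *: << t 0 i >>).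
    under [RHS]eq_bigr => u _ do rewrite scalerBr scaler_sumr.
    rewrite sumrB -freeg_combination exchange_big; congr (_ - _).
    apply: eq_bigr => i _; rewrite {1}(freeg_combination z) linear_sum summxE.
    rewrite scaler_suml; apply: eq_bigr => u _.
    by rewrite linearZ mxE scalerA.
  by apply: lin_span_sum => u; apply: lin_spanZ (tensor_gen u).
by rewrite Lz0 big1 ?subr0 // => i _; rewrite mxE scale0r.
Qed.

Lemma tensor_basis_det (M : 'M[B]_mu) :
  tensor_basis f g (fun i => (t *m map_mx f M) 0 i) <-> g (\det M) != 0.
Proof.
have [L [kerL LE]] := tensor_coordinates_exist.
have Lcomb a : L (\sum_i a i *: << (t *m map_mx f M) 0 i >>) =
    map_mx g M *m \col_i a i.
  rewrite linear_sum; apply/colP=> j; rewrite summxE [RHS]mxE.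
  by apply: eq_bigr => i _; rewrite linearZ /= LE !mxE mulrC.
rewrite -det_map_mx; split=> [[free _] | detM].
  apply/negP; rewrite -det_tr => /det0P[v v_neq0 vM0]; case/negP: v_neq0.
  apply/eqP/rowP=> i; rewrite [RHS]mxE; apply: (free (v 0)); apply/kerL.
  rewrite Lcomb; apply: trmx_inj; rewrite trmx_mul trmx0 -[RHS]vM0.
  by congr (_ *m _); apply/rowP=> j; rewrite !mxE.
have unitM : map_mx g M \in unitmx by rewrite unitmxE unitfE.
split=> [a /kerL | z].
  rewrite Lcomb => Ma0 i; have := mulKmx unitM (\col_i a i).
  by rewrite Ma0 mulmx0 => /colP/(_ i); rewrite !mxE.
exists (fun i => (invmx (map_mx g M) *m L z) i 0); apply/kerL.
rewrite linearB /= Lcomb; apply/eqP; rewrite subr_eq0; apply/eqP.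
rewrite -[LHS](mulKVmx unitM); congr (_ *m _).
by apply/colP=> i; rewrite [RHS]mxE.
Qed.

End TensorBasis.
(** * Points of the schemes *)

Section Overlap.
Variables (K : fieldType) (n mu alpha alpha' : nat).
Variable P : pseudo_order_ideal K n mu alpha.
Variable P' : pseudo_order_ideal K n mu alpha'.

Lemma to_residue_eq0 (R : comPzRingType) (p : prime_ideal R) x :
  to_residue p x = 0 <-> p x.
Proof.
rewrite -[p x]/(prime_ideal_val p x) -(rproj_eq0 (prime_ideal_val p) x) /=.
by split=> [/eqP|->]; [rewrite tofrac_eq0 => /eqP | rewrite tofrac0].
Qed.

Lemma in_overlap_det (MC : 'M[{mpoly K[mu * alpha]}]_mu) :
  map_mx (poly_to_U P) (poi_terms P') =
    map_mx (poly_to_U P) (poi_terms P) *m map_mx (coord_to_U P) MC ->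
  forall p : prime_ideal (B_ring P),
    in_overlap P' p <-> ~ p (rproj (I_scheme P) (\det MC)).
Proof.
move=> hMC p; have eqB : B_to_U P \o rproj (I_scheme P) =1 coord_to_U P.
  exact: B_to_U_rproj.
have := tensor_basis_det (to_residue p) (U_basis P)
  (map_mx (rproj (I_scheme P)) MC).
rewrite -map_mx_comp (eq_map_mx _ eqB) -hMC det_map_mx.
have -> : (fun i => map_mx (poly_to_U P) (poi_terms P') 0 i) =
    (fun i => poly_to_U P (poi_terms P' 0 i)).
  by apply: funext => i; rewrite mxE.
rewrite /in_overlap => ->; rewrite -to_residue_eq0.
by split=> [/eqP | /eqP].
Qed.

End Overlap.

Section PointQuotient.
Variables (K F : fieldType) (n : nat).

Definition point_scalar (I : ideal {mpoly F[n]}) : {rmorphism F -> rquot I} :=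
  rproj I \o mpolyC n (R := F).

Definition point_poly (c : {rmorphism K -> F}) (I : ideal {mpoly F[n]}) :
    {rmorphism {mpoly K[n]} -> rquot I} :=
  rproj I \o map_mpoly (n := n) c.

Lemma point_combination c I mu (t : 'rV[{mpoly K[n]}]_mu) (a : 'cV[F]_mu) :
  (map_mx (point_poly c I) t *m map_mx (point_scalar I) a) 0 0 =
  rproj I (\sum_i a i 0 *: map_mpoly c (t 0 i)).
Proof.
rewrite mxE rmorph_sum; apply: eq_bigr => i _.
by rewrite -mul_mpolyC rmorphM mulrC; congr (_ * _); rewrite mxE.
Qed.

End PointQuotient.

Section FieldPoints.
Variables (K : fieldType) (n mu alpha : nat).
Variable P : pseudo_order_ideal K n mu alpha.
Variables (F : fieldType) (u : {rmorphism B_ring P -> F}).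
Variables (c : {rmorphism K -> F}) (J : ideal {mpoly F[n]}).
Hypothesis cE : forall x, c x = u (const_to_B P x).
Hypothesis JE : forall f, J f <-> ideal_at u f.

Local Notation uC := (u \o rproj (I_scheme P)).

Lemma map_poly_lift p : map_mpoly uC (poly_lift K n mu alpha p) = map_mpoly c p.
Proof.
have /(_ p) // : map_mpoly (n := n) uC \o poly_lift K n mu alpha =1 map_mpoly c.
apply: mpoly_hom_ext => [x | i] /=; last by rewrite !map_mpolyX.
by rewrite !map_mpolyC; congr (_%:MP); apply: esym (cE x).
Qed.

Lemma point_relations : border_relations P (point_scalar J) uC (point_poly c J).
Proof.
pose e : {rmorphism {mpoly {mpoly K[mu * alpha]}[n]} -> rquot J} :=
  rproj J \o map_mpoly (n := n) uC.
have e_lift : e \o poly_lift K n mu alpha =1 point_poly c J.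
  by move=> p; rewrite /= map_poly_lift.
have e_const :
    e \o mpolyC n (R := {mpoly K[mu * alpha]}) =1 point_scalar J \o uC.
  by move=> a; rewrite /= map_mpolyC.
apply/(@generic_basis_eval_eq0 _ _ _ _ P _ _ _ _ _ e e_lift e_const) => j.
by apply/rproj_eq0/JE/mem_ideal_gen; exists j.
Qed.

Lemma point_spanned w :
  spanned (point_scalar J) (map_mx (point_poly c J) (poi_terms P)) w.
Proof.
have [q ->] := rproj_surj w.
elim/mpoly_monomials_ind: q => [|p q sp sq|a m].
- by rewrite rmorph0; apply: spanned0.
- by rewrite rmorphD; apply: spannedD.
have -> : rproj J (a%:MP * 'X_[m]) = point_scalar J a * point_poly c J 'X_[m].
  by rewrite rmorphM /= map_mpolyX.
exact: spannedZ (poly_spanned point_relations _).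
Qed.

(** The coordinates of the monomials in the universal family, specialized
    along [u], define a linear map that vanishes on the ideal of the point. *)
Lemma point_basis :
  module_basis (point_scalar J) (map_mx (point_poly c J) (poi_terms P)).
Proof.
split=> [a Ta0 | w]; last exact: point_spanned.
have [b [_ bD bZ bM]] := coordinates_exist (U_basis P).
have b0 : b 0 = 0 by apply: (@addrI _ (b 0)); rewrite -bD !addr0.
have [L LX] := mpoly_linear_exists (fun m => map_mx u (b (poly_to_U P 'X_[m]))).
have LE q : L (map_mpoly uC q) = map_mx u (b (rproj (I_univ P) q)).
  elim/mpoly_monomials_ind: q => [|p q IHp IHq|d m].
  - by rewrite !rmorph0 linear0 b0 map_mx0.
  - by rewrite !rmorphD linearD bD map_mxD IHp IHq.
  have -> : rproj (I_univ P) (d%:MP * 'X_[m]) =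
      B_to_U P (rproj (I_scheme P) d) * poly_to_U P 'X_[m].
    by rewrite rmorphM B_to_U_rproj /= [poly_lift _ _ _ _ _]map_mpolyX.
  rewrite bZ map_mxZ rmorphM /= map_mpolyC map_mpolyX mul_mpolyC linearZ.
  by rewrite LX.
have L_J p : J p -> L p = 0.
  move=> /JE [m [h [s [Ss ->]]]]; rewrite linear_sum big1 // => i _.
  have [j ->] := Ss i; elim/mpoly_monomials_ind: (h i) => [|f g Lf Lg|d r].
  - by rewrite mul0r linear0.
  - by rewrite mulrDl linearD Lf Lg addr0.
  have -> : d%:MP * 'X_[r] * map_mpoly uC (generic_basis P j) =
      d *: map_mpoly uC ('X_[r] * generic_basis P j).
    by rewrite rmorphM /= map_mpolyX -mulrA mul_mpolyC.
  rewrite linearZ LE.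
  have /rproj_eq0 -> : I_univ P ('X_[r] * generic_basis P j).
    by apply/idealM/mem_ideal_gen; right; exists j.
  by rewrite b0 map_mx0; apply: scaler0.
have L_term l : L (map_mpoly c (poi_terms P 0 l)) = delta_mx l 0.
  have -> : L (map_mpoly c (poi_terms P 0 l)) =
      map_mx u (b (poly_to_U P (poi_terms P 0 l))).
    by rewrite -map_poly_lift LE.
  have := bM 1%:M l; rewrite map_mx1 mulmx1 mxE => ->.
  by apply/colP=> i; rewrite !mxE rmorph_nat eqxx andbT.
have : J (\sum_i a i 0 *: map_mpoly c (poi_terms P 0 i)).
  by apply/rproj_eq0; rewrite -point_combination Ta0 mxE.
move=> /L_J; rewrite linear_sum => /colP La0; apply/colP=> i.
rewrite -[RHS](La0 i) summxE (bigD1 i) //= big1 => [|j neq_ji].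
  by rewrite linearZ /= L_term !mxE !eqxx mulr1 addr0.
by rewrite linearZ /= L_term !mxE eq_sym (negbTE neq_ji) mulr0.
Qed.

End FieldPoints.

(** * The transition homomorphisms *)

Section TransitionRelations.
Variables (K : fieldType) (n mu alpha alpha' : nat).
Variable P : pseudo_order_ideal K n mu alpha.
Variable P' : pseudo_order_ideal K n mu alpha'.
Variables (MC : 'M[{mpoly K[mu * alpha]}]_mu).
Variables (NC : 'M[{mpoly K[mu * alpha]}]_(mu, alpha')).
Hypothesis hMC : map_mx (poly_to_U P) (poi_terms P') =
  map_mx (poly_to_U P) (poi_terms P) *m map_mx (coord_to_U P) MC.
Hypothesis hNC : map_mx (poly_to_U P) (poi_border P') =
  map_mx (poly_to_U P) (poi_terms P) *m map_mx (coord_to_U P) NC.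

(** The equalities assumed over the universal family hold in every algebra
    that it maps to.  There [P' D = P M_C D], to be compared with
    [b P' = P N_C]. *)
Lemma border_relations_transition (R V : comPzRingType) (f : {rmorphism R -> V})
    (g : {rmorphism {mpoly K[mu * alpha]} -> R})
    (g' : {rmorphism {mpoly K[mu * alpha']} -> R})
    (pi : {rmorphism {mpoly K[n]} -> V}) :
  border_relations P f g pi -> (forall a, I_scheme P a -> g a = 0) ->
  (forall x : K, g' x%:MP = g x%:MP) ->
  [/\ map_mx pi (poi_terms P') =
        map_mx pi (poi_terms P) *m map_mx f (map_mx g MC),
      map_mx pi (poi_border P') =
        map_mx pi (poi_terms P) *m map_mx f (map_mx g NC)
    & map_mx g MC *m map_mx g' (coord_mx K mu alpha') = map_mx g NC ->
      border_relations P' f g' pi].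
Proof.
move=> rel g0 g'C; have [h [h_poly h_coord]] := U_hom_exists rel g0.
have transport p q (A : 'M_(1, p)) (M : 'M_(_, q)) (B : 'M_(1, q)) :
    map_mx (poly_to_U P) B =
      map_mx (poly_to_U P) A *m map_mx (coord_to_U P) M ->
    map_mx pi B = map_mx pi A *m map_mx f (map_mx g M).
  move/(congr1 (map_mx h)); rewrite map_mxM -!map_mx_comp.
  by rewrite !(eq_map_mx _ h_poly) (eq_map_mx _ h_coord).
have TE := transport _ _ _ _ _ hMC; have BE := transport _ _ _ _ _ hNC.
split=> // MD; split=> [x | ]; first by rewrite g'C rel.1.
by rewrite TE BE -mulmxA -map_mxM MD.
Qed.

End TransitionRelations.

Section LocalizedUniversalFamily.
Variables (K : fieldType) (n mu alpha : nat).
Variables (P : pseudo_order_ideal K n mu alpha).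
Variable M : 'M[{mpoly K[mu * alpha]}]_mu.

Lemma coord_to_B_det_kill a : I_scheme P a -> coord_to_B_det P M a = 0.
Proof. by move=> /rproj_eq0 a0; rewrite /= a0 rmorph0. Qed.

Lemma localized_universal_family_exists :
  exists (V : comPzRingType) (f : {rmorphism B_det P M -> V})
         (pi : {rmorphism {mpoly K[n]} -> V}),
    border_relations P f (coord_to_B_det P M) pi /\
    module_basis f (map_mx pi (poi_terms P)).
Proof.
pose d := rproj (I_scheme P) (\det M).
have [f fE] := @loc_hom_exists _ d _
  (loc_map (B_to_U P d) \o B_to_U P) (loc_inv (B_to_U P d)) (loc_mapV _).
exists (loc (B_to_U P d)), f, (loc_map (B_to_U P d) \o poly_to_U P).
have [relC relB] := U_relations P; split.
  split=> [x | ].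
    by rewrite -[LHS]fE; congr loc_map; apply: relC.
  rewrite map_mx_comp relB map_mxM -!map_mx_comp; congr (_ *m _).
  by apply: eq_map_mx => a; apply: fE.
rewrite map_mx_comp; apply: localized_basis (U_basis P) => b.
exact: esym (fE b).
Qed.

End LocalizedUniversalFamily.

Section Transition.
Variables (K : fieldType) (n mu alpha alpha' : nat).
Variable P : pseudo_order_ideal K n mu alpha.
Variable P' : pseudo_order_ideal K n mu alpha'.
Variables (MC : 'M[{mpoly K[mu * alpha]}]_mu).
Variables (NC : 'M[{mpoly K[mu * alpha]}]_(mu, alpha')).
Variables (MD : 'M[{mpoly K[mu * alpha']}]_mu).
Hypothesis hMC : map_mx (poly_to_U P) (poi_terms P') =
  map_mx (poly_to_U P) (poi_terms P) *m map_mx (coord_to_U P) MC.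
Hypothesis hNC : map_mx (poly_to_U P) (poi_border P') =
  map_mx (poly_to_U P) (poi_terms P) *m map_mx (coord_to_U P) NC.

Local Notation Q := (coord_to_B_det P MC).
Local Notation Q' := (coord_to_B_det P' MD).

(** The second basis [P'] of the localized universal family of [P] provides
    [Phi]; pushing the equalities for [M_D] and [N_D] along it shows that it
    extends to the localization and computes the image of [N_D]. *)
Lemma transition_exists (ND : 'M[{mpoly K[mu * alpha']}]_(mu, alpha))
    (hMD : map_mx (poly_to_U P') (poi_terms P) =
       map_mx (poly_to_U P') (poi_terms P') *m map_mx (coord_to_U P') MD)
    (hND : map_mx (poly_to_U P') (poi_border P) =
       map_mx (poly_to_U P') (poi_terms P') *m map_mx (coord_to_U P') ND) :
  exists Phi : {rmorphism B_det P' MD -> B_det P MC},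
    [/\ forall x : K, Phi (Q' x%:MP) = Q x%:MP,
        map_mx (Phi \o Q') (coord_mx K mu alpha') =
          inv_in_B_det P MC *m map_mx Q NC
      & map_mx (Phi \o Q') ND =
          map_mx (Phi \o Q') MD *m map_mx Q (coord_mx K mu alpha)].
Proof.
have [V [f [pi [rel TB]]]] := localized_universal_family_exists P MC.
have [g [gC gD]] := coord_hom_exists (Q \o mpolyC (mu * alpha) (R := K))
  (inv_in_B_det P MC *m map_mx Q NC).
have [TE BE rel'] := border_relations_transition hMC hNC rel
  (@coord_to_B_det_kill _ _ _ _ P MC) gC.
have {}rel' : border_relations P' f g pi.
  by apply: rel'; rewrite gD mulmxA mulmx_inv_in_B_det mul1mx.
have T'B : module_basis f (map_mx pi (poi_terms P')).
  by rewrite TE; apply: basis_transition TB; apply: mulmx_inv_in_B_det.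
have g_kill := coordinates_kill_scheme rel' T'B.
have [TE' BE' _] := border_relations_transition hMD hND rel' g_kill (fsym gC).
have MCD : map_mx Q MC *m map_mx g MD = 1%:M.
  apply: (basis_inj TB); rewrite /= map_mxM mulmxA -TE -TE'.
  by rewrite map_mx1 mulmx1.
have NDE : map_mx g ND = map_mx g MD *m map_mx Q (coord_mx K mu alpha).
  by apply: (basis_inj T'B); rewrite /= map_mxM mulmxA -TE' -BE' rel.2.
pose gB : {rmorphism B_ring P' -> B_det P MC} := rquot_lift g_kill.
have gBE a : gB (rproj (I_scheme P') a) = g a by apply: rquot_lift_rproj.
have [|Phi PhiE] := @loc_hom_exists _ (rproj (I_scheme P') (\det MD)) _ gB
    (Q (\det MC)).
  by rewrite gBE -!det_map_mx mulrC -det_mulmx MCD det1.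
have PhiQ : g =1 Phi \o Q' by move=> a; rewrite -gBE PhiE.
exists Phi; split=> [x | | ]; first by rewrite -[LHS]PhiQ gC.
  by rewrite -(eq_map_mx _ PhiQ).
by rewrite -!(eq_map_mx _ PhiQ).
Qed.

Section InducedMap.
Variable Phi : {rmorphism B_det P' MD -> B_det P MC}.
Hypothesis PhiC : forall x : K, Phi (Q' x%:MP) = Q x%:MP.
Hypothesis PhiD : map_mx (Phi \o Q') (coord_mx K mu alpha') =
  inv_in_B_det P MC *m map_mx Q NC.

Let wPhiD (F : fieldType) (w : {rmorphism B_det P MC -> F}) :
  map_mx (w \o Phi \o Q') (coord_mx K mu alpha') =
  map_mx w (inv_in_B_det P MC) *m map_mx (w \o Q) NC.
Proof.
rewrite (map_mx_comp Q w) -map_mxM -PhiD -map_mx_comp.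
by apply: eq_map_mx.
Qed.

Let w_inv (F : fieldType) (w : {rmorphism B_det P MC -> F}) :
  map_mx (w \o Q) MC *m map_mx w (inv_in_B_det P MC) = 1%:M.
Proof. by rewrite map_mx_comp -map_mxM mulmx_inv_in_B_det map_mx1. Qed.

Section PointsOfTransition.
Variables (F : fieldType) (u : {rmorphism B_ring P -> F}).
Variables (v : {rmorphism B_ring P' -> F}).
Hypothesis eqC : forall a : K, u (const_to_B P a) = v (const_to_B P' a).

Let c : {rmorphism K -> F} := u \o const_to_B P.
Let J := ideal_at u.
Let uC : {rmorphism {mpoly K[mu * alpha]} -> F} := u \o rproj (I_scheme P).
Let vC : {rmorphism {mpoly K[mu * alpha']} -> F} := v \o rproj (I_scheme P').

Let rel : border_relations P (point_scalar J) uC (point_poly c J).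
Proof. by apply: point_relations. Qed.

Let TB : module_basis (point_scalar J) (map_mx (point_poly c J) (poi_terms P)).
Proof. exact: (@point_basis _ _ _ _ P _ u). Qed.

Let uC_kill a : I_scheme P a -> uC a = 0.
Proof. by move=> /rproj_eq0 a0; rewrite /uC /= a0 rmorph0. Qed.

Let transition := @border_relations_transition _ _ _ _ _ P P' MC NC hMC hNC
  _ _ (point_scalar J) uC vC (point_poly c J) rel uC_kill (fsym eqC).

(** Both [P] and [P'] are bases modulo the common ideal, so [M_C] becomes
    invertible over [F], which gives [w]; comparing the two expressions of
    [b P'] in the basis [P] forces the values of the coordinates [D]. *)
Lemma same_ideal_factors :
  (forall f, ideal_at u f <-> ideal_at v f) ->
  exists w : {rmorphism B_det P MC -> F},
    u =1 w \o B_to_B_det P MC /\ v =1 w \o Phi \o B_to_B_det P' MD.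
Proof.
move=> eq_ideal.
have [TE BE _] := transition.
have rel' : border_relations P' (point_scalar J) vC (point_poly c J).
  exact: (@point_relations _ _ _ _ P' F v c J eqC eq_ideal).
have T'B :
    module_basis (point_scalar J) (map_mx (point_poly c J) (poi_terms P')).
  exact: (@point_basis _ _ _ _ P' F v c J eqC eq_ideal).
have [N MN] : exists N, map_mx uC MC *m N = 1%:M.
  by apply: (basis_transition_inv TB); rewrite -TE.
have [|w wE] := @loc_hom_exists _ (rproj (I_scheme P) (\det MC)) _ u (\det N).
  by rewrite -[u _]/(uC _) -det_map_mx -det_mulmx MN det1.
exists w; split=> // b; have [a ->] := rproj_surj b; move: a.
have wQ : uC =1 w \o Q by move=> a; apply: wE.
have vD : map_mx (w \o Q) MC *m map_mx vC (coord_mx K mu alpha') =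
    map_mx (w \o Q) NC.
  rewrite -!(eq_map_mx _ wQ); apply: (basis_inj TB).
  by rewrite /= map_mxM mulmxA -TE -BE rel'.2.
change (vC =1 w \o Phi \o Q'); apply: coord_hom_ext => [x | ].
  by rewrite -[LHS]eqC [RHS](congr1 w (PhiC x)); apply: wE.
by rewrite wPhiD -vD mulmxA (mulmx1C (w_inv w)) mul1mx.
Qed.

(** The relations of [P'] hold modulo the ideal of [u], which gives one
    inclusion.  For the other, a polynomial of the ideal of [u] is, modulo the
    ideal of [v], a combination of [P'] lying in the ideal of [u]; it is zero
    since [P'] is independent modulo the latter. *)
Lemma factors_same_ideal (w : {rmorphism B_det P MC -> F}) :
  u =1 w \o B_to_B_det P MC -> v =1 w \o Phi \o B_to_B_det P' MD ->
  forall f, ideal_at u f <-> ideal_at v f.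
Proof.
move=> uE vE.
have wQ : uC =1 w \o Q by move=> a; apply: uE.
have wQ' : vC =1 w \o Phi \o Q' by move=> a; apply: vE.
have [TE BE rel'] := transition.
have {}rel' : border_relations P' (point_scalar J) vC (point_poly c J).
  apply: rel'; rewrite !(eq_map_mx _ wQ) (eq_map_mx _ wQ') wPhiD mulmxA.
  by rewrite w_inv mul1mx.
have T'B :
    module_basis (point_scalar J) (map_mx (point_poly c J) (poi_terms P')).
  rewrite TE; apply: basis_transition TB; last first.
    by rewrite (eq_map_mx _ wQ); apply: w_inv.
have sub_vu f : ideal_at v f -> ideal_at u f.
  apply: ideal_gen_min => _ [j ->]; apply/(rproj_eq0 J).
  pose e : {rmorphism {mpoly {mpoly K[mu * alpha']}[n]} -> rquot J} :=
    rproj J \o map_mpoly (n := n) vC.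
  have e_lift : e \o poly_lift K n mu alpha' =1 point_poly c J.
    by move=> p; rewrite /e /= (@map_poly_lift _ _ _ _ P' F v c eqC p).
  have e_const :
      e \o mpolyC n (R := {mpoly K[mu * alpha']}) =1 point_scalar J \o vC.
    by move=> a; rewrite /e /= map_mpolyC.
  have eP := @generic_basis_eval_eq0 _ _ _ _ P' _ _ _ _ _ e e_lift e_const.
  exact: eP.1 rel' j.
move=> f; split=> [Juf|]; last exact: sub_vu.
have [a fE] := @point_spanned _ _ _ _ P' F v c (ideal_at v) eqC
  (fun=> iff_refl _) (rproj (ideal_at v) f).
move: fE; rewrite point_combination => /eqP.
rewrite -subr_eq0 -rmorphB => /eqP/rproj_eq0 Jv.
have a0 : a = 0.
  apply: T'B.1; apply/matrixP=> i j; rewrite !ord1 point_combination mxE.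
  apply/rproj_eq0; rewrite -[X in J X](subrK f) -opprB.
  rewrite addrC; apply: idealB => //; exact: sub_vu.
move: Jv; rewrite a0 big1 ?subr0 // => i _.
by rewrite mxE scale0r.
Qed.

End PointsOfTransition.

(** The inverse of [det M_C] maps to a unit, so a fraction is killed exactly
    when its numerator is. *)
Lemma extension_kernel (F : fieldType) (u : {rmorphism B_ring P -> F})
    (w : {rmorphism B_det P MC -> F}) (p : ideal (B_ring P)) :
  u =1 w \o B_to_B_det P MC -> (forall b, u b = 0 <-> p b) ->
  forall y, w y = 0 <->
    ideal_gen (fun x => exists2 b, p b & x = B_to_B_det P MC b) y.
Proof.
move=> uE up y; split=> [|[m [a [s [Ss ->]]]]]; last first.
  rewrite rmorph_sum big1 // => i _; have [b pb ->] := Ss i.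
  by rewrite rmorphM -[w (B_to_B_det _ _ _)]uE (up b).2 // mulr0.
have [b [k ->]] := loc_surj y; rewrite rmorphM rmorphXn -[w (loc_map _ _)]uE.
have inv_neq0 : w (loc_inv _) != 0.
  apply/eqP=> inv0.
  have /eqP := congr1 w (loc_mapV (rproj (I_scheme P) (\det MC))).
  by rewrite rmorphM inv0 mulr0 rmorph1 eq_sym oner_eq0.
move=> /eqP; rewrite mulf_eq0 expf_eq0 (negbTE inv_neq0) andbF orbF => /eqP ub0.
by rewrite mulrC; apply/idealM/mem_ideal_gen; exists b => //; apply/up.
Qed.

Lemma is_transitionP : is_transition NC Phi.
Proof.
split=> // [F u v | p p' p_overlap].
  split=> [[eqC eq_ideal] | [eqC [w [uE vE]]]]; split=> //.
    exact: same_ideal_factors.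
  exact: (factors_same_ideal eqC uE vE).
split=> [[F [u [v [up vp' [eqC eq_ideal]]]]] b | p'E].
  have [w [uE vE]] := same_ideal_factors eqC eq_ideal.
  by rewrite -(extension_kernel uE up) -vp' vE.
have detN0 : to_residue p (rproj (I_scheme P) (\det MC)) != 0.
  by apply/eqP => /to_residue_eq0; apply: (in_overlap_det hMC p).1.
(* The residue field of [p] already carries points over [p] and [p']. *)
have [|w wE] := @loc_hom_exists _ (rproj (I_scheme P) (\det MC)) _
    (to_residue p) (to_residue p (rproj (I_scheme P) (\det MC)))^-1.
  by rewrite mulfV.
pose v : {rmorphism B_ring P' -> residue_field p} :=
  w \o Phi \o B_to_B_det P' MD.
have eqC x : to_residue p (const_to_B P x) = v (const_to_B P' x).
  by rewrite [LHS]wE; apply: esym (congr1 w (PhiC x)).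
exists (residue_field p), (to_residue p), v; split=> [b | b | ].
- exact: to_residue_eq0.
- by rewrite p'E -(extension_kernel wE (to_residue_eq0 p)).
by split=> //; apply: (factors_same_ideal eqC wE).
Qed.

End InducedMap.

(** On coordinates, [Phi (Psi C) = Phi(M_D)^-1 Phi(N_D)]. *)
Lemma transition_cancel (ND : 'M[{mpoly K[mu * alpha']}]_(mu, alpha))
    (Phi : {rmorphism B_det P' MD -> B_det P MC})
    (Psi : {rmorphism B_det P MC -> B_det P' MD}) :
  (forall x : K, Phi (Q' x%:MP) = Q x%:MP) ->
  (forall x : K, Psi (Q x%:MP) = Q' x%:MP) ->
  map_mx (Phi \o Q') ND =
    map_mx (Phi \o Q') MD *m map_mx Q (coord_mx K mu alpha) ->
  map_mx (Psi \o Q) (coord_mx K mu alpha) =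
    inv_in_B_det P' MD *m map_mx Q' ND ->
  cancel Psi Phi.
Proof.
move=> PhiC PsiC PhiND PsiC'.
suff: Phi \o Psi =1 idfun by [].
apply: loc_hom_ext => b; have [a ->] := rproj_surj b; move: a.
change ((Phi \o Psi) \o Q =1 Q); apply: coord_hom_ext => [x | ].
  by rewrite /= PsiC PhiC.
have -> : map_mx (Phi \o Psi \o Q) (coord_mx K mu alpha) =
    map_mx Phi (map_mx (Psi \o Q) (coord_mx K mu alpha)).
  by rewrite -map_mx_comp; apply: eq_map_mx.
rewrite PsiC' map_mxM -map_mx_comp PhiND (map_mx_comp Q' Phi) mulmxA -map_mxM.
by rewrite inv_in_B_det_mulmx map_mx1 mul1mx.
Qed.

End Transition.

Theorem theorem2p7 (K : fieldType) (n mu alpha alpha' : nat)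
    (P : pseudo_order_ideal K n mu alpha)
    (P' : pseudo_order_ideal K n mu alpha')
    (MC : 'M[{mpoly K[mu * alpha]}]_mu)
    (NC : 'M[{mpoly K[mu * alpha]}]_(mu, alpha'))
    (MD : 'M[{mpoly K[mu * alpha']}]_mu)
    (ND : 'M[{mpoly K[mu * alpha']}]_(mu, alpha))
    (hMC : map_mx (poly_to_U P) (poi_terms P') =
           map_mx (poly_to_U P) (poi_terms P) *m map_mx (coord_to_U P) MC)
    (hNC : map_mx (poly_to_U P) (poi_border P') =
           map_mx (poly_to_U P) (poi_terms P) *m map_mx (coord_to_U P) NC)
    (hMD : map_mx (poly_to_U P') (poi_terms P) =
           map_mx (poly_to_U P') (poi_terms P') *m map_mx (coord_to_U P') MD)
    (hND : map_mx (poly_to_U P') (poi_border P) =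
           map_mx (poly_to_U P') (poi_terms P') *m map_mx (coord_to_U P') ND) :
  ((forall p : prime_ideal (B_ring P),
      in_overlap P' p <-> ~ p (rproj (I_scheme P) (\det MC))) /\
   (forall p' : prime_ideal (B_ring P'),
      in_overlap P p' <-> ~ p' (rproj (I_scheme P') (\det MD)))) /\
  (exists (Phi : {rmorphism B_det P' MD -> B_det P MC})
          (Psi : {rmorphism B_det P MC -> B_det P' MD}),
     [/\ is_transition NC Phi, is_transition ND Psi,
         cancel Phi Psi & cancel Psi Phi]).
Proof.
split; first by split; apply: in_overlap_det.
have [Phi [PhiC PhiD PhiND]] := transition_exists hMC hNC hMD hND.
have [Psi [PsiC PsiC' PsiNC]] := transition_exists hMD hND hMC hNC.
exists Phi, Psi; split.
- exact: is_transitionP.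
- exact: is_transitionP.
- exact: (transition_cancel PsiC PhiC PsiNC PhiD).
- exact: (transition_cancel PhiC PsiC PhiND PsiC').
Qed.
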